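(* Let $\mathfrak{A}$ be a unital $C^*$-algebra and let $\varphi$ be a spreadable (resp. exchangeable) state on $\ast_{\mathbb{N}}\mathfrak{A}$. The following are equivalent: (i) $\mathcal{T}_\varphi=\mathbb{C}$ (i.e. the tail algebra of $\varphi$ consists only of scalar multiples of the identity); (ii) $\varphi$ is forward-decoupling (resp. is block-singleton); (iii) $\varphi$ is $\pi_{\varphi_{\mathbb{Z}}}$-attractive.
   Context: $\mathbb{N}=\{0,1,2,\dots\}$. $\ast_{\mathbb{N}}\mathfrak{A}$ and $\ast_{\mathbb{Z}}\mathfrak{A}$ are the unital free product $C^*$-algebras (units amalgamated) of copies of $\mathfrak{A}$ indexed by $\mathbb{N}$, resp. $\mathbb{Z}$, with canonical unital embeddings $i_j$ of $\mathfrak{A}$; $\ast_{\mathbb{N}}\mathfrak{A}\subset\ast_{\mathbb{Z}}\mathfrak{A}$. For an injective map $f$ of the index set, $\alpha_f$ is the unital $*$-endomorphism with $\alpha_f(i_j(a))=i_{f(j)}(a)$; $\tau=\alpha_f$ for $f(j)=j+1$ is the shift (an automorphism on $\ast_{\mathbb{Z}}\mathfrak{A}$). $\mathbb{P}_{\mathbb{N}}$ is the group of bijections of $\mathbb{N}$ moving only finitely many points; $\mathbb{J}_{\mathbb{N}}$ is the semigroup of strictly increasing maps $h:\mathbb{N}\to\mathbb{N}$ with $|\mathbb{N}\setminus h(\mathbb{N})|<\infty$. A state $\varphi$ on $\ast_{\mathbb{N}}\mathfrak{A}$ is stationary if $\varphi\circ\tau=\varphi$, spreadable if $\varphi\circ\alpha_h=\varphi$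 for all $h\in\mathbb{J}_{\mathbb{N}}$ (equivalently for all strictly increasing maps), exchangeable if $\varphi\circ\alpha_\sigma=\varphi$ for all $\sigma\in\mathbb{P}_{\mathbb{N}}$ (exchangeable implies spreadable implies stationary). $(\pi_\varphi,\mathcal{H}_\varphi,\xi_\varphi)$ is the GNS triple of $\varphi$. Tail algebra: $\mathcal{T}_\varphi:=\bigcap_{n\in\mathbb{N}}\{\pi_\varphi(i_k(\mathfrak{A})):k\ge n\}''\subset\mathcal{B}(\mathcal{H}_\varphi)$. Bilateral extension: $\varphi_{\mathbb{Z}}$ is the unique shift-invariant state on $\ast_{\mathbb{Z}}\mathfrak{A}$ extending the stationary state $\varphi$; $\pi_{\varphi_{\mathbb{Z}}}$ is its GNS representation on $\mathcal{H}_{\varphi_{\mathbb{Z}}}$, regarded here as a representation of $\ast_{\mathbb{N}}\mathfrak{A}$. For a representation $\pi$ of $\ast_{\mathbb{N}}\mathfrak{A}$ on $\mathcal{H}_\pi$, $\mathcal{S}_\pi$ is the set of states $\omega(\cdot)=\mathrm{tr}(\pi(\cdot)T)$ with $T\in\mathcal{B}(\mathcal{H}_\pi)$ positive, $\mathrm{tr}(T)=1$. A stationary state $\varphi$ is $\pi$-attractive if $\lim_{n\to\infty}\omega(\tau^n(x))=\varphi(x)$ for every $\omega\in\mathcal{S}_\pi$ and every $x\in\ast_{\mathbb{N}}\mathfrak{A}$. An element $x\in\ast_{\mathbb{N}}\mathfrak{A}$ is localized with support contained in a finite set $F\subset\mathbb{N}$ if $x\in\ast_F\mathfrak{A}$,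 the $C^*$-subalgebra generated by $i_j(\mathfrak{A})$, $j\in F$. For finite sets, $F>G$ means $\min F>\max G$. A stationary state $\varphi$ is forward-decoupling (resp. block-singleton) if $\varphi(xyz)=\varphi(xz)\varphi(y)$ for all localized $x,y,z$ with supports contained in finite sets $F_x,F_y,F_z$ such that $F_y>F_x\cup F_z$ (resp. $F_y\cap(F_x\cup F_z)=\emptyset$). *)

(* Defs.v *)
From HB Require Import structures.
From mathcomp Require Import all_boot all_order all_algebra.
From mathcomp Require Import complex.
From mathcomp Require Import all_classical all_reals all_analysis.
From mathcomp.analysis Require Import showcase.summability.

Set Implicit Arguments.
Unset Strict Implicit.
Unset Printing Implicit Defensive.

Import Order.TTheory GRing.Theory Num.Theory.
Import numFieldNormedType.Exports.

Local Open Scope classical_set_scope.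
Local Open Scope ring_scope.

(** The complex scalars are [R[i]] for [R : realType].  As usual in MathComp,
    norms over [R[i]] take (nonnegative real) values in [R[i]], and [0 <= z] for
    [z : R[i]] means that [z] is real and nonnegative.  [R[i]^o] is [R[i]] with
    its topology.

    Unital C*-algebras.  A join of normed modules and rings would have to sit
    below [numDomainType], so the norm [cnorm] is a field here, and
    [cnorm_entourage] makes the uniform structure that of the norm.
    [algType] imposes [1 != 0]; the zero algebra has no states, so nothing is
    lost. *)
HB.mixin Record isCStarAlgebra (R : realType) A
    & Uniform A & GRing.Algebra R[i] A := {
  cnorm : A -> R[i] ;
  cnorm_ge0 : forall x : A, 0 <= cnorm x ;
  cnorm0_eq0 : forall x : A, cnorm x = 0 -> x = 0 ;
  ler_cnormD : forall x y : A, cnorm (x + y) <= cnorm x + cnorm y ;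
  cnormZ : forall (a : R[i]) (x : A), cnorm (a *: x) = `|a| * cnorm x ;
  ler_cnormM : forall x y : A, cnorm (x * y) <= cnorm x * cnorm y ;
  cnorm_entourage : forall E : set (A * A), entourage E <->
    exists2 e : R[i], 0 < e & [set xy | cnorm (xy.1 - xy.2) < e] `<=` E ;
  cnorm_complete : forall F : set_system A, ProperFilter F -> cauchy F ->
    exists x : A, F --> x ;
  star : A -> A ;
  starD : forall x y : A, star (x + y) = star x + star y ;
  starZ : forall (a : R[i]) (x : A), star (a *: x) = a^* *: star x ;
  starM : forall x y : A, star (x * y) = star y * star x ;
  starK : forall x : A, star (star x) = x ;
  cnorm_star : forall x : A, cnorm (star x * x) = cnorm x ^+ 2
}.

#[short(type="cstarAlgType")]
HB.structure Definition CStarAlgebra (R : realType) :=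
  {A of Uniform A & GRing.Algebra R[i] A & isCStarAlgebra R A}.

(** Hilbert spaces; the inner product is linear in its first argument. *)
HB.mixin Record isHilbert (R : realType) H & CompleteNormedModule R[i] H := {
  dot : H -> H -> R[i] ;
  dotPl : forall (a : R[i]) (u v w : H),
    dot (a *: u + v) w = a * dot u w + dot v w ;
  dotC : forall u v : H, dot v u = (dot u v)^* ;
  norm_dot : forall u : H, `|u| ^+ 2 = dot u u
}.

#[short(type="hilbertType")]
HB.structure Definition Hilbert (R : realType) :=
  {H of CompleteNormedModule R[i] H & isHilbert R H}.

Section CStarTheory.
Context {R : realType}.

Definition unital_starhom (A B : cstarAlgType R) (f : A -> B) : Prop :=
  [/\ linear f, f 1 = 1, forall x y, f (x * y) = f x * f y
    & forall x, f (star x) = star (f x)].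

Definition cstar_subalgebra (A : cstarAlgType R) (S : set A) : Prop :=
  [/\ closed S, S 1,
      forall (a : R[i]) x y, S x -> S y -> S (a *: x + y),
      forall x y, S x -> S y -> S (x * y)
    & forall x, S x -> S (star x)].

Definition cstar_generated (A : cstarAlgType R) (G : set A) : set A :=
  smallest (@cstar_subalgebra A) G.

Definition is_state (A : cstarAlgType R) (phi : A -> R[i]) : Prop :=
  [/\ scalar phi, forall x, 0 <= phi (star x * x) & phi 1 = 1].

End CStarTheory.

(** Unital free product of copies of [A] indexed by [J], determined up to a
    unique isomorphism by its universal property.  The morphism in
    [fp_universal] is unique because of [fp_generated], and the [fp_emb j] are
    injective (take [B := A] and identities in [fp_universal]). *)
Record freeProduct (R : realType) (J : Type) (A : cstarAlgType R) := FreeProduct {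
  fp_alg :> cstarAlgType R ;
  fp_emb : J -> A -> fp_alg ;
  fp_emb_starhom : forall j, unital_starhom (fp_emb j) ;
  fp_generated : cstar_generated (\bigcup_j range (fp_emb j)) = setT ;
  fp_universal : forall (B : cstarAlgType R) (f : J -> A -> B),
    (forall j, unital_starhom (f j)) ->
    exists F : fp_alg -> B,
      unital_starhom F /\ forall j a, F (fp_emb j a) = f j a
}.

Arguments fp_emb {R J A} P j a : rename.
Arguments fp_emb_starhom {R J A} P j : rename.
Arguments fp_universal {R J A} P {B f} _ : rename.

Section FreeProduct.
Context {R : realType} {A : cstarAlgType R}.

(** The unital *-homomorphism with [i_j(a) |-> i_(f j)(a)]. *)
Definition fp_map (J K : Type) (P : freeProduct J A) (Q : freeProduct K A)
    (f : J -> K) : P -> Q :=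
  projT1 (cid (fp_universal P (fun j => fp_emb_starhom Q (f j)))).

Arguments fp_map {J K} P Q f _.

Definition fp_alpha (J : Type) (P : freeProduct J A) (f : J -> J) : P -> P :=
  fp_map P P f.

Definition fp_shiftN (P : freeProduct nat A) : P -> P := fp_alpha succn.

Definition fp_shiftZ (Q : freeProduct int A) : Q -> Q :=
  fp_alpha (fun j : int => j + 1).

(** Injective, with left inverse [fp_map Q P absz]. *)
Definition fp_inclusion (P : freeProduct nat A) (Q : freeProduct int A) :
    P -> Q :=
  fp_map P Q Posz.

End FreeProduct.
Arguments fp_shiftN {R A} P _.
Arguments fp_shiftZ {R A} Q _.
Arguments fp_inclusion {R A} P Q _.

Section States.
Context {R : realType} {A : cstarAlgType R} (P : freeProduct nat A).
Implicit Type phi : P -> R[i].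

Definition finite_perm (s : nat -> nat) : Prop :=
  bijective s /\ finite_set [set n | s n <> n].

Definition cofinite_increasing (h : nat -> nat) : Prop :=
  {homo h : m n / (m < n)%N} /\ finite_set (~` range h).

Definition spreadable phi : Prop :=
  forall h, cofinite_increasing h -> forall x, phi (fp_alpha h x) = phi x.

Definition exchangeable phi : Prop :=
  forall s, finite_perm s -> forall x, phi (fp_alpha s x) = phi x.

Definition localized (F : set nat) (x : P) : Prop :=
  cstar_generated (\bigcup_(j in F) range (fp_emb P j)) x.

Definition decoupled_on (far : set nat -> set nat -> Prop) phi : Prop :=
  forall (Fx Fy Fz : set nat) (x y z : P),
    finite_set Fx -> finite_set Fy -> finite_set Fz ->
    localized Fx x -> localized Fy y -> localized Fz z ->
    far Fy (Fx `|` Fz) ->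
    phi (x * y * z) = phi (x * z) * phi y.

Definition forward_decoupling : (P -> R[i]) -> Prop :=
  decoupled_on (fun F G => forall j k, F j -> G k -> (k < j)%N).

Definition block_singleton : (P -> R[i]) -> Prop :=
  decoupled_on (fun F G => F `&` G = set0).

Definition bilateral_extension (Q : freeProduct int A) phi
    (phiZ : Q -> R[i]) : Prop :=
  [/\ is_state phiZ,
      forall x, phiZ (fp_shiftZ Q x) = phiZ x
    & forall x, phiZ (fp_inclusion P Q x) = phi x].

End States.

Section Operators.
Context {R : realType} {H : hilbertType R}.

Definition bounded_operator (T : H -> H) : Prop := linear T /\ continuous T.

(** The commutant in B(H). *)
Definition commutant (S : set (H -> H)) : set (H -> H) :=
  [set T | bounded_operator T /\ forall s, S s -> T \o s = s \o T].

Definition scalar_operators : set (H -> H) :=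
  [set T | exists c : R[i], T = (fun u => c *: u)].

Definition positive_operator (T : H -> H) : Prop :=
  bounded_operator T /\ forall u, 0 <= dot (T u) u.

(** Orthonormal bases (maximal orthonormal families) of a possibly
    nonseparable space. *)
Definition orthonormal_basis (I : choiceType) (e : I -> H) : Prop :=
  (forall i j, dot (e i) (e j) = (i == j)%:R) /\
  forall u, (forall i, dot u (e i) = 0) -> u = 0.

(** [T] has trace [t]: the sum of the [<T e_i, e_i>] converges unconditionally
    to [t], whatever the orthonormal basis. *)
Definition has_trace (T : H -> H) (t : R[i]) : Prop :=
  forall (I : choiceType) (e : I -> H), orthonormal_basis e ->
    partial_sum (fun i => dot (T (e i)) (e i) : R[i]^o) @ totally
      --> (t : R[i]^o).

Definition representation (A : cstarAlgType R) (pi : A -> H -> H) : Prop :=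
  [/\ forall x, bounded_operator (pi x),
      forall (a : R[i]) x y u, pi (a *: x + y) u = a *: pi x u + pi y u,
      forall u, pi 1 u = u,
      forall x y u, pi (x * y) u = pi x (pi y u)
    & forall x u v, dot (pi (star x) u) v = dot u (pi x v)].

Definition is_GNS (A : cstarAlgType R) (phi : A -> R[i])
    (pi : A -> H -> H) (xi : H) : Prop :=
  [/\ representation pi,
      closure (range (fun x => pi x xi)) = setT
    & forall x, phi x = dot (pi x xi) xi].

Definition normal_states (A : cstarAlgType R) (pi : A -> H -> H) :
    set (A -> R[i]) :=
  [set w | exists T, [/\ positive_operator T, has_trace T 1
                       & forall x, has_trace (pi x \o T) (w x)]].

Definition attractive (A : cstarAlgType R) (P : freeProduct nat A)
    (pi : P -> H -> H) (phi : P -> R[i]) : Prop :=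
  forall w, normal_states pi w -> forall x : P,
    (fun n => w (iter n (fp_shiftN P) x) : R[i]^o) @ \oo
      --> (phi x : R[i]^o).

Definition tail_algebra (A : cstarAlgType R) (P : freeProduct nat A)
    (pi : P -> H -> H) : set (H -> H) :=
  \bigcap_(n in [set: nat])
    commutant (commutant
      [set T | exists k a, (n <= k)%N /\ T = pi (fp_emb P k a)]).

End Operators.

(* Main.v *)
Require Import Defs.
From HB Require Import structures.
From mathcomp Require Import all_boot all_order all_algebra.
From mathcomp Require Import finmap complex ring lra.
From mathcomp Require Import all_classical all_reals all_analysis.
From mathcomp.analysis Require Import showcase.summability.

Set Implicit Arguments.
Unset Strict Implicit.
Unset Printing Implicit Defensive.

Import Order.TTheory GRing.Theory Num.Theory.
Import numFieldNormedType.Exports.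

Local Open Scope classical_set_scope.
Local Open Scope ring_scope.

(** Write [tau] for the shift and [x], [z] for elements supported in [[0, m)], [y]
    for one supported in [[m, oo)].  Opening a gap at position [m] is an increasing
    map, so spreadability gives [phi (x * tau ^ n y * z) = phi (x * y * z)] for all
    [n] (lemma [spread_word]).  All three properties express that [pi (tau ^ n y)]
    tends weakly to the scalar [phi y].

    - If the tail algebra is trivial, let [T] be the weak limit of [pi (tau ^ n y)]
      along an ultrafilter.  It is a tail operator, hence a scalar, necessarily
      [phi y]; comparing matrix coefficients gives
      [phi (x * y * z) = phi (x * z) * phi y] (lemma [tail_decoupling]).
    - If the state decouples and [T] is a tail operator, then for every vector [u]
      of the dense orbit [T u] is a limit of vectors [pi y u] with [y] supported
      arbitrarily far away.  Decoupling says that the coefficients of [pi y u]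
      against the orbit are [phi y] times those of [u]; so [u] is an eigenvector of
      [T], and an operator with a dense subspace of eigenvectors is a scalar (lemma
      [decoupling_tail]).
    - Let [pi_Z] be the representation of the bilateral extension.  Decoupling and
      shift invariance say that [<pi_Z (tau ^ n x) u, v>] tends to [phi x <u, v>]
      for [u], [v] in the orbit, and for all vectors by density (lemma
      [decoupling_mixing]).  This convergence passes to normal states because the
      tails of the sums computing [tr (pi_Z (tau ^ n x) T)] are small uniformly in
      [n] (lemma [mixing_attractive]).  Conversely vector states are normal, so
      attractiveness gives back the convergence of matrix coefficients by
      polarization (lemma [attractive_mixing]); the coefficients for
      [u = pi_Z z xi_Z] and [v = pi_Z (star x) xi_Z] form the constant sequence
      [phi (x * y * z)], whence decoupling (lemma [mixing_decoupling]).

    For an exchangeable state, finite permutations realize every injection on a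
    finite set of indices.  Therefore the state is spreadable, and the support of
    [y] can be moved beyond those of [x] and [z] as soon as it is disjoint from
    them: forward decoupling is the same as the block-singleton property (lemma
    [block_singletonP]).

    Two devices keep this elementary.  Supports are handled in the *-algebras
    generated by the letters ([word_algebra]), on which maps of indices act by pure
    algebra; one passes to C*-algebras at the end, through bounded functionals.
    And every estimate uniform in [n] rests on the contractivity of
    representations ([representation_norm]), applied to [pi \o tau ^ n]. *)

Local Notation Re := complex.Re.
Local Notation Im := complex.Im.

(** * Complex modulus and positive sesquilinear forms *)

Section ComplexModulus.
Context {R : realType}.
Implicit Types (z w : R[i]) (t : R).

(** The order of [R[i]] is partial and real arithmetic does not apply to it: norms
    are replaced throughout by their real values. *)
Definition cmod z : R := Re `|z|.

Lemma normc_cmod z : `|z| = (cmod z)%:C%C.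
Proof. by rewrite /cmod normc_def. Qed.

Lemma cmod_ge0 z : 0 <= cmod z.
Proof. by rewrite -ler0c -normc_cmod normr_ge0. Qed.

Lemma sqr_cmod z : cmod z ^+ 2 = Re z ^+ 2 + Im z ^+ 2.
Proof. by rewrite /cmod normc_def /= sqr_sqrtr // addr_ge0 // sqr_ge0. Qed.

Lemma cmodD z w : cmod (z + w) <= cmod z + cmod w.
Proof. by rewrite -lecR rmorphD /= -!normc_cmod ler_normD. Qed.

Lemma cmodM z w : cmod (z * w) = cmod z * cmod w.
Proof. by apply: complexI; rewrite rmorphM /= -!normc_cmod normrM. Qed.

Lemma cmodN z : cmod (- z) = cmod z.
Proof. by rewrite /cmod normrN. Qed.

Lemma cmod0 : cmod 0 = 0.
Proof. by rewrite /cmod normr0. Qed.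

Lemma cmod1 : cmod 1 = 1.
Proof. by rewrite /cmod normr1. Qed.

Lemma cmod_eq0 z : cmod z = 0 -> z = 0.
Proof. by move=> z0; apply/eqP; rewrite -normr_eq0 normc_cmod z0. Qed.

Lemma cmod_conj z : cmod z^* = cmod z.
Proof. by rewrite /cmod norm_conjC. Qed.

Lemma conjC_real t : (t%:C%C)^* = t%:C%C :> R[i].
Proof. exact: conjc_real. Qed.

Lemma cmod_real t : cmod t%:C%C = `|t|.
Proof. by rewrite /cmod normc_def /= expr0n addr0 sqrtr_sqr. Qed.

Lemma Re_le_cmod z : `|Re z| <= cmod z.
Proof.
rewrite -(@ler_pXn2r _ 2) ?nnegrE ?cmod_ge0 ?normr_ge0 // sqr_cmod.
by rewrite real_normK ?num_real // lerDl sqr_ge0.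
Qed.

Lemma Im_le_cmod z : `|Im z| <= cmod z.
Proof.
rewrite -(@ler_pXn2r _ 2) ?nnegrE ?cmod_ge0 ?normr_ge0 // sqr_cmod.
by rewrite real_normK ?num_real // lerDr sqr_ge0.
Qed.

Lemma cmod_le_ReIm z : cmod z <= `|Re z| + `|Im z|.
Proof.
rewrite -(@ler_pXn2r _ 2) ?nnegrE ?cmod_ge0 ?addr_ge0 ?normr_ge0 // sqr_cmod.
rewrite sqrrD !real_normK ?num_real // addrAC lerDl.
by rewrite mulrn_wge0 // mulr_ge0 ?normr_ge0.
Qed.

Lemma ge0_ReC z : 0 <= z -> z = (Re z)%:C%C.
Proof. by move=> z0; rewrite RRe_real // realE z0. Qed.

Lemma ge0_Re z : 0 <= z -> 0 <= Re z.
Proof. by rewrite lecE => /andP[_]. Qed.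

Lemma ltr_posC (e : R[i]) : 0 < e -> exists2 d : R, 0 < d & e = d%:C%C.
Proof.
move=> e0; exists (Re e); last by apply: ge0_ReC; exact: ltW.
by move: e0; rewrite ltcE => /andP[_].
Qed.

Lemma cmod_sum (I : Type) (r : seq I) (P : pred I) (f : I -> R[i]) :
  cmod (\sum_(i <- r | P i) f i) <= \sum_(i <- r | P i) cmod (f i).
Proof.
elim/big_ind2: _ => [|x1 x2 y1 y2 h1 h2|//]; first by rewrite cmod0.
by rewrite (le_trans (cmodD _ _)) // lerD.
Qed.

Lemma cmod_small_eq0 z (c : R) : (forall e : R, 0 < e -> cmod z <= c * e) -> z = 0.
Proof.
move=> h; apply: cmod_eq0; apply/eqP; rewrite eq_le cmod_ge0 andbT.
apply/ler_addgt0Pl => e e0; rewrite addr0.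
have c1 : 0 < `|c| + 1 by rewrite ltr_wpDl.
apply: le_trans (h (e / (`|c| + 1)) _) _; first by rewrite divr_gt0.
rewrite mulrCA ler_piMr ?(ltW e0) // ler_pdivrMr // mul1r.
by rewrite (le_trans (ler_norm c)) // lerDl.
Qed.

(** Stated for forms rather than for inner products: the degenerate forms
    [<T u, v>] of positive operators [T] need the same inequalities. *)
Section PositiveForm.
Context {V : lmodType R[i]} (B : V -> V -> R[i]).
Context (Bl : forall a (u v w : V), B (a *: u + v) w = a * B u w + B v w).
Context (Br : forall a (u v w : V), B w (a *: u + v) = a^* * B w u + B w v).
Context (B_ge0 : forall u, 0 <= B u u).

Lemma form_expand a u v :
  B (a *: u + v) (a *: u + v) =
  a * a^* * B u u + a * B u v + a^* * B v u + B v v.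
Proof. by rewrite Bl !Br; ring. Qed.

Lemma form_herm u v : B v u = (B u v)^*.
Proof.
(* the expansion of [B (a u + v) (a u + v)] is real; take [a = 1] and [a = i] *)
have h a : Im (a * B u v + a^* * B v u) = 0.
  have := form_expand a u v.
  rewrite (ge0_ReC (B_ge0 _)) (ge0_ReC (B_ge0 u)) (ge0_ReC (B_ge0 v)).
  move: (Re _) (Re _) (Re _) (B u v) (B v u) => p q r [x y] [x' y'].
  case: a => a b /= -[_] ->.
  ring.
move: (h 1) (h 'i%C) => {h}; case: (B u v) (B v u) => [x y] [x' y'] /=.
move=> h1 h2; apply/eqP; rewrite eq_complex /=; apply/andP; split; apply/eqP; lra.
Qed.

Lemma form_CauchySchwarz u v : cmod (B u v) ^+ 2 <= Re (B u u) * Re (B v v).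
Proof.
have p0 := ge0_Re (B_ge0 u); have q0 := ge0_Re (B_ge0 v).
have h t : 0 <= t ^+ 2 * cmod (B u v) ^+ 2 * Re (B u u)
                - 2 * t * cmod (B u v) ^+ 2 + Re (B v v).
  have := B_ge0 (- t%:C%C * (B u v)^* *: u + v); rewrite form_expand (form_herm u v).
  rewrite (ge0_ReC (B_ge0 u)) (ge0_ReC (B_ge0 v)) => /ge0_Re.
  rewrite sqr_cmod; move: (Re (B u u)) (Re (B v v)) (B u v) => p q [x y] /=.
  by move=> h; apply: (le_trans h); rewrite le_eqVlt; apply/orP; left; apply/eqP; ring.
move: p0 q0 h; move: (Re (B u u)) (Re (B v v)) (cmod _ ^+ 2) (sqr_ge0 (cmod (B u v))).
move=> p q k k0; rewrite le_eqVlt => /orP[/eqP <-|p0] q0 h.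
  rewrite mul0r leNgt; apply/negP => kp.
  (* this [t] makes the affine function [q - 2 * t * k] equal to [-1] *)
  have := h ((q + 1) / (2 * k)).
  suff -> : ((q + 1) / (2 * k)) ^+ 2 * k * 0 - 2 * ((q + 1) / (2 * k)) * k + q = - 1 by lra.
  by field; rewrite lt0r_neq0.
have := h p^-1.
have -> : p^-1 ^+ 2 * k * p - 2 * p^-1 * k + q = q - k / p by field; rewrite lt0r_neq0.
by rewrite subr_ge0 ler_pdivrMr // mulrC.
Qed.

(** The square-root-free form of the Cauchy-Schwarz inequality, in which sums
    of such estimates can be bounded term by term. *)
Lemma form_CauchySchwarz_weighted t u v : 0 < t ->
  2 * cmod (B u v) <= t * Re (B u u) + t^-1 * Re (B v v).
Proof.
move=> t0; have := form_CauchySchwarz u v; have := cmod_ge0 (B u v).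
have := ge0_Re (B_ge0 u); have := ge0_Re (B_ge0 v).
move: (Re (B u u)) (Re (B v v)) (cmod _) => p q k q0 p0 k0 h.
have tp : 0 <= t * p + t^-1 * q by rewrite addr_ge0 // mulr_ge0 // ?invr_ge0 ltW.
have k2 : 0 <= 2 * k by lra.
rewrite -(@ler_pXn2r _ 2) ?nnegrE //.
have -> : (t * p + t^-1 * q) ^+ 2 = (t * p - t^-1 * q) ^+ 2 + 4 * (p * q).
  by field; rewrite lt0r_neq0.
rewrite exprMn; have := sqr_ge0 (t * p - t^-1 * q); lra.
Qed.

End PositiveForm.
End ComplexModulus.

(** * Inner product and topology of a Hilbert space *)

Section HilbertNorm.
Context {R : realType} {H : hilbertType R}.
Implicit Types (u v w : H) (a : R[i]) (S M : set H).

Definition hnorm u : R := Re `|u|.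

Lemma normr_hnorm u : `|u| = (hnorm u)%:C%C.
Proof. exact: ge0_ReC. Qed.

Lemma hnorm_ge0 u : 0 <= hnorm u. Proof. exact: ge0_Re. Qed.

Lemma hnormD u v : hnorm (u + v) <= hnorm u + hnorm v.
Proof. by rewrite -lecR rmorphD /= -!normr_hnorm ler_normD. Qed.

Lemma hnormN u : hnorm (- u) = hnorm u.
Proof. by rewrite /hnorm normrN. Qed.

Lemma hnormB u v : hnorm (u - v) = hnorm (v - u).
Proof. by rewrite /hnorm distrC. Qed.

Lemma hnorm0 : hnorm 0 = 0.
Proof. by rewrite /hnorm normr0. Qed.

Lemma hnormZ a u : hnorm (a *: u) = cmod a * hnorm u.
Proof.
by apply: complexI; rewrite rmorphM /= -normr_hnorm normrZ normc_cmod -normr_hnorm.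
Qed.

Lemma hnorm_eq0 u : hnorm u = 0 -> u = 0.
Proof. by move=> u0; apply/eqP; rewrite -normr_eq0 normr_hnorm u0. Qed.

Lemma dotZDl a u v w : dot (a *: u + v) w = a * dot u w + dot v w.
Proof. exact: dotPl. Qed.

Lemma dotDl u v w : dot (u + v) w = dot u w + dot v w.
Proof. by rewrite -[u in LHS]scale1r dotPl mul1r. Qed.

Lemma dot0l w : dot 0 w = 0 :> R[i].
Proof. by apply: (addrI (dot 0 w)); rewrite -dotDl !addr0. Qed.

Lemma dotZl a u w : dot (a *: u) w = a * dot u w.
Proof. by rewrite -[a *: u]addr0 dotPl dot0l addr0. Qed.

Lemma dotNl u w : dot (- u) w = - dot u w.
Proof. by rewrite -scaleN1r dotZl mulN1r. Qed.

Lemma dotBl u v w : dot (u - v) w = dot u w - dot v w.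
Proof. by rewrite dotDl dotNl. Qed.

Lemma dotZDr a u v w : dot w (a *: u + v) = a^* * dot w u + dot w v.
Proof. by rewrite dotC dotPl rmorphD rmorphM /= -!dotC. Qed.

Lemma dotDr u v w : dot w (u + v) = dot w u + dot w v.
Proof. by rewrite dotC dotDl rmorphD /= -!dotC. Qed.

Lemma dot0r w : dot w 0 = 0 :> R[i].
Proof. by rewrite dotC dot0l rmorph0. Qed.

Lemma dotZr a u w : dot w (a *: u) = a^* * dot w u.
Proof. by rewrite dotC dotZl rmorphM /= -!dotC. Qed.

Lemma dotNr u w : dot w (- u) = - dot w u.
Proof. by rewrite dotC dotNl rmorphN /= -!dotC. Qed.

Lemma dotBr u v w : dot w (u - v) = dot w u - dot w v.
Proof. by rewrite dotDr dotNr. Qed.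

Lemma dot_suml (I : Type) (r : seq I) (p : pred I) (f : I -> H) w :
  dot (\sum_(i <- r | p i) f i) w = \sum_(i <- r | p i) dot (f i) w.
Proof.
elim/big_ind2: _ => [|x1 x2 y1 y2 <- <-|//]; first exact: dot0l.
exact: dotDl.
Qed.

Lemma dot_sumr (I : Type) (r : seq I) (p : pred I) (f : I -> H) w :
  dot w (\sum_(i <- r | p i) f i) = \sum_(i <- r | p i) dot w (f i).
Proof. by rewrite dotC dot_suml rmorph_sum; apply: eq_bigr => i _; rewrite /= -dotC. Qed.

Lemma dot_ge0 u : 0 <= dot u u :> R[i].
Proof. by rewrite -norm_dot exprn_ge0. Qed.

Lemma sqr_hnorm u : hnorm u ^+ 2 = Re (dot u u).
Proof. by rewrite -norm_dot normr_hnorm -rmorphXn. Qed.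

Lemma dot_hnorm u : dot u u = (hnorm u ^+ 2)%:C%C.
Proof. by rewrite sqr_hnorm -ge0_ReC // dot_ge0. Qed.

Lemma CauchySchwarz u v : cmod (dot u v) <= hnorm u * hnorm v.
Proof.
rewrite -(@ler_pXn2r _ 2) ?nnegrE ?cmod_ge0 ?mulr_ge0 ?hnorm_ge0 // exprMn !sqr_hnorm.
by apply: (form_CauchySchwarz dotZDl dotZDr dot_ge0).
Qed.

Lemma sqr_hnormD u v :
  hnorm (u + v) ^+ 2 = hnorm u ^+ 2 + 2 * Re (dot u v) + hnorm v ^+ 2.
Proof.
rewrite !sqr_hnorm dotDl !dotDr (dotC u v).
move: (dot u u) (dot v v) (dot u v) => [p p'] [q q'] [x y] /=; ring.
Qed.

Lemma sqr_hnormB u v :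
  hnorm (u - v) ^+ 2 = hnorm u ^+ 2 - 2 * Re (dot u v) + hnorm v ^+ 2.
Proof. by rewrite sqr_hnormD hnormN dotNr raddfN /= mulrN. Qed.

Lemma parallelogram u v :
  hnorm (u + v) ^+ 2 + hnorm (u - v) ^+ 2 = 2 * hnorm u ^+ 2 + 2 * hnorm v ^+ 2.
Proof. by rewrite sqr_hnormD sqr_hnormB; ring. Qed.

Lemma hnorm_le_dot u (c : R) : 0 <= c ->
  (forall v, cmod (dot u v) <= c * hnorm v) -> hnorm u <= c.
Proof.
move=> c0 h; have := h u; rewrite dot_hnorm cmod_real ger0_norm ?sqr_ge0 // expr2.
have := hnorm_ge0 u; rewrite le_eqVlt => /orP[/eqP <- //|u0].
by rewrite ler_pM2r.
Qed.

Lemma dot_extr u v : (forall w, dot u w = dot v w) -> u = v.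
Proof.
move=> h; apply: subr0_eq; apply: hnorm_eq0; apply/eqP.
by rewrite -sqrf_eq0 sqr_hnorm dotBl h subrr.
Qed.

Lemma closureP S u :
  closure S u <-> forall e : R, 0 < e -> exists2 v, S v & hnorm (u - v) < e.
Proof.
split=> [cl e e0|h B].
  have eC : 0 < e%:C%C :> R[i] by rewrite ltcR.
  have [v [Sv]] := cl _ (nbhsx_ballx u _ eC).
  by rewrite -ball_normE /ball_ /= normr_hnorm ltcR => uv; exists v.
move=> /nbhs_ballP[e /= /ltr_posC[d d0 ->]].
rewrite -ball_normE /ball_ => sB; have [v Sv uv] := h d d0; exists v; split=> //.
by apply: sB; rewrite /= normr_hnorm ltcR.
Qed.

Lemma bounded_operatorP (T : H -> H) : bounded_operator T <->
  linear T /\ exists2 c : R, 0 <= c & forall u, hnorm (T u) <= c * hnorm u.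
Proof.
split=> [[lT cT]|[lT [c c0 h]]]; split=> //.
  pose L : {linear H -> H} := HB.pack T (GRing.isLinear.Build _ _ _ _ T lT).
  have cL : {for 0, continuous L} by exact: cT.
  have /linear_boundedP[M [Mr]] := @continuous_linear_bounded _ _ _ 0 _ cL.
  have [m ->] : exists m : R, M = m%:C%C by exists (Re M); rewrite RRe_real.
  move=> /(_ (`|m| + 1)%:C%C) hM; exists (`|m| + 1); first by rewrite ltW // ltr_wpDl.
  move=> u; rewrite -lecR rmorphM /= -!normr_hnorm; apply: hM.
  by rewrite ltcR (le_lt_trans (ler_norm m)) // ltrDl.
pose L : {linear H -> H} := HB.pack T (GRing.isLinear.Build _ _ _ _ T lT).
apply: (@bounded_linear_continuous _ _ _ L); apply/linear_boundedP.
exists c%:C%C; split; first by apply/complex_realP; exists c.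
move=> e ce u; apply: le_trans (_ : c%:C%C * `|u| <= _); last by rewrite ler_wpM2r // ltW.
by rewrite !normr_hnorm -rmorphM lecR h.
Qed.

Lemma hnorm_complete (f : nat -> H) :
  (forall e : R, 0 < e -> exists N, forall m n, (N <= m)%N -> (N <= n)%N ->
     hnorm (f m - f n) < e) ->
  exists l, forall e : R, 0 < e ->
    exists N, forall n, (N <= n)%N -> hnorm (f n - l) < e.
Proof.
move=> h; have cf : cauchy (f @ \oo).
  apply/cauchyP => e /ltr_posC[d d0 ->]; have [N hN] := h d d0.
  exists (f N); exists N => // n /= Nn.
  by rewrite -ball_normE /ball_ /= normr_hnorm ltcR hN.
have [l hl] : exists l : H, f @ \oo --> l by apply/cvg_ex; exact: (@cauchy_cvg _ _ _ cf).
exists l => e e0; have eC : 0 < e%:C%C :> R[i] by rewrite ltcR.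
have [N _ hN] := hl _ (nbhsx_ballx l _ eC).
exists N => n Nn; have := hN n Nn.
by rewrite -ball_normE /ball_ /= normr_hnorm ltcR hnormB.
Qed.

End HilbertNorm.

(** * Orthogonal projection and the Riesz representation theorem *)

Section Projection.
Context {R : realType} {H : hilbertType R}.
Implicit Types (u v w : H) (a : R[i]) (S M : set H).

Definition subspace M : Prop :=
  M 0 /\ forall a u v, M u -> M v -> M (a *: u + v).

Lemma subspaceZ M a u : subspace M -> M u -> M (a *: u).
Proof. by move=> [M0 MZD] Mu; rewrite -[a *: u]addr0; exact: MZD. Qed.

Lemma subspaceD M u v : subspace M -> M u -> M v -> M (u + v).
Proof. by move=> [_ MZD] Mu Mv; rewrite -[u]scale1r; exact: MZD. Qed.

(** A minimizing sequence for the distance to [M] is Cauchy by the parallelogram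
    identity, and its limit differs from [u] by a vector orthogonal to [M] because
    moving along [m] cannot decrease the distance. *)
Lemma projection M u : subspace M ->
  exists p, closure M p /\ forall m, M m -> dot (u - p) m = 0.
Proof.
move=> sM; have [M0 MZD] := sM.
pose D : set R := [set hnorm (u - m) ^+ 2 | m in M].
have Dinf : has_inf D.
  split; first by exists (hnorm (u - 0) ^+ 2); exists 0.
  by exists 0 => _ [m _ <-]; exact: sqr_ge0.
have infD m : M m -> inf D <= hnorm (u - m) ^+ 2.
  by move=> Mm; apply: ge_inf; [exact: Dinf.2|exists m].
have minD (n : nat) : exists m, M m /\ hnorm (u - m) ^+ 2 < inf D + n.+1%:R^-1.
  have n0 : 0 < n.+1%:R^-1 :> R by rewrite invr_gt0.
  have [_ [m Mm <-] hm] := inf_adherent n0 Dinf.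
  by exists m.
have [f hf] := choice minD.
have fM n : M (f n) by have [] := hf n.
have fD n : hnorm (u - f n) ^+ 2 <= inf D + n.+1%:R^-1 by have [_ /ltW] := hf n.
have invle (N n : nat) : (N <= n)%N -> n.+1%:R^-1 <= N.+1%:R^-1 :> R.
  by move=> Nn; rewrite lef_pV2 ?posrE // ler_nat ltnS.
have small (e : R) : 0 < e -> exists N : nat, N.+1%:R^-1 < e.
  move=> e0; exists (Num.bound e^-1); rewrite invf_plt ?posrE //.
  by rewrite (lt_trans (archi_boundP _)) ?invr_ge0 ?ltW // ltr_nat.
have fC (e : R) : 0 < e -> exists N, forall m n, (N <= m)%N -> (N <= n)%N ->
    hnorm (f m - f n) < e.
  move=> e0; have [N hN] := small (e ^+ 2 / 4) ltac:(by rewrite divr_gt0 ?exprn_gt0).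
  exists N => m n Nm Nn.
  rewrite -(@ltr_pXn2r _ 2) ?nnegrE ?hnorm_ge0 ?(ltW e0) //.
  have := parallelogram (u - f m) (u - f n).
  have -> : u - f m - (u - f n) = f n - f m by rewrite opprB addrC addrA subrK.
  rewrite hnormB.
  have -> : u - f m + (u - f n) = 2%:R *: (u - 2%:R^-1 *: (f m + f n)).
    rewrite scalerBr scalerA divff ?pnatr_eq0 // scale1r scaler_nat mulr2n.
    by rewrite opprD addrACA.
  rewrite hnormZ exprMn.
  have -> : cmod (2%:R : R[i]) = 2.
    by have -> : (2%:R : R[i]) = (2%:R : R)%:C%C; [rewrite rmorph_nat|rewrite cmod_real ger0_norm].
  have := infD (2%:R^-1 *: (f m + f n)) (subspaceZ _ sM (subspaceD sM (fM m) (fM n))).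
  have := fD m; have := fD n; have := invle _ _ Nm; have := invle _ _ Nn.
  move: hN; move: (N.+1%:R^-1) (n.+1%:R^-1) (m.+1%:R^-1) (hnorm (f m - f n) ^+ 2).
  move: (hnorm (u - f n) ^+ 2) (hnorm (u - f m) ^+ 2) (e ^+ 2).
  move: (hnorm (u - 2^-1 *: (f m + f n)) ^+ 2) (inf D).
  move=> x1 x2 x3 x4 x5 x6 x7 x8 x9; rewrite -natrX; lra.
have [p hp] := hnorm_complete fC.
exists p; split.
  apply/closureP => e e0; have [N hN] := hp e e0.
  by exists (f N); rewrite // hnormB hN.
move=> m Mm.
have key n : cmod (dot (u - f n) m) ^+ 2 <= hnorm m ^+ 2 * n.+1%:R^-1.
  have [->|m0] := eqVneq m 0.
    by rewrite dot0r cmod0 hnorm0 expr0n /= mul0r.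
  have q0 : 0 < hnorm m ^+ 2.
    rewrite exprn_gt0 // lt_neqAle hnorm_ge0 andbT eq_sym.
    by apply: contra m0 => /eqP/hnorm_eq0/eqP.
  (* [f n + a *: m] is the point of the line closest to [u] *)
  pose a := dot (u - f n) m / (hnorm m ^+ 2)%:C%C.
  have := infD _ (MZD a _ _ Mm (fM n)); have := fD n.
  have -> : u - (a *: m + f n) = (u - f n) - a *: m by rewrite addrAC opprD addrA.
  rewrite (sqr_hnormB (u - f n)) hnormZ dotZr exprMn /a cmodM rmorphM /= -mulrA mulrCA.
  have -> : (dot (u - f n) m)^* * dot (u - f n) m = (cmod (dot (u - f n) m) ^+ 2)%:C%C.
    by rewrite mulrC -normCK normc_cmod rmorphXn.
  rewrite -fmorphV conjC_real cmod_real ger0_norm ?invr_ge0 ?(ltW q0) // -rmorphM /=.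
  rewrite exprMn; move: (cmod (dot (u - f n) m) ^+ 2) (hnorm m ^+ 2) q0 => k q q0.
  move: (hnorm (u - f n) ^+ 2) (n.+1%:R^-1) (inf D) => h j d h1.
  have -> : h - 2 * (q^-1 * k) + k * q^-1 ^+ 2 * q = h - k / q by field; rewrite lt0r_neq0.
  by move=> h2; rewrite mulrC -ler_pdivrMr //; move: (k / q) h2 => x h2; lra.
apply: (@cmod_small_eq0 _ _ (2 * hnorm m)) => e e0.
have [N hN] := hp e e0; have [N' hN'] := small (e ^+ 2) (exprn_gt0 _ e0).
pose n := maxn N N'.
have -> : u - p = (u - f n) + (f n - p) by rewrite addrA subrK.
rewrite dotDl (le_trans (cmodD _ _)) // -mulrA mulr2n mulrDl mul1r lerD //; last first.
  apply: (le_trans (CauchySchwarz _ _)); rewrite mulrC ler_wpM2l ?hnorm_ge0 //.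
  by rewrite ltW // hN // leq_maxl.
rewrite -(@ler_pXn2r _ 2) ?nnegrE ?cmod_ge0 ?mulr_ge0 ?hnorm_ge0 ?(ltW e0) //.
rewrite exprMn (le_trans (key n)) // ler_wpM2l ?sqr_ge0 //.
by rewrite (le_trans (invle N' _ _)) ?leq_maxr // ltW.
Qed.

Lemma closure_bounded_eq0 M (f : H -> R[i]) (c : R) u :
  (forall u v, f (u - v) = f u - f v) -> (forall u, cmod (f u) <= c * hnorm u) ->
  (forall m, M m -> f m = 0) -> closure M u -> f u = 0.
Proof.
move=> fB fc fM /closureP cl; apply: (@cmod_small_eq0 _ _ `|c|) => e e0.
have [m Mm um] := cl e e0.
have -> : f u = f (u - m) by rewrite fB (fM m) // subr0.
rewrite (le_trans (fc _)) // (le_trans (ler_wpM2r (hnorm_ge0 _) (ler_norm c))) //.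
by rewrite ler_wpM2l // ltW.
Qed.

Lemma dot_closure0 M u v : (forall m, M m -> dot m v = 0) -> closure M u -> dot u v = 0.
Proof.
move=> h; apply: (@closure_bounded_eq0 M (fun u => dot u v) (hnorm v)) => //.
  by move=> x y; rewrite dotBl.
by move=> x; rewrite mulrC CauchySchwarz.
Qed.

(** A functional [f <> 0] vanishes on a proper closed subspace; a vector [w0]
    orthogonal to it represents [f] up to a scalar, since [f w0 *: u - f u *: w0]
    lies in the kernel. *)
Lemma Riesz (f : H -> R[i]) (c : R) :
  (forall a u v, f (a *: u + v) = a * f u + f v) ->
  (forall u, cmod (f u) <= c * hnorm u) -> exists w, forall u, f u = dot u w.
Proof.
move=> fl fc.
have f0 : f 0 = 0 by apply: (addrI (1 * f 0)); rewrite -fl scale1r !addr0 mul1r.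
have fB u v : f (u - v) = f u - f v.
  by rewrite addrC -scaleN1r fl mulN1r addrC.
have [fz|] := pselect (forall u, f u = 0).
  by exists 0 => u; rewrite dot0r fz.
move=> /existsNP[u0 /eqP fu0]; pose M : set H := [set u | f u = 0].
have sM : subspace M by split=> // a u v; rewrite /M /= fl => -> ->; rewrite mulr0 addr0.
have [p [clp orth]] := projection u0 sM.
have fp : f p = 0 by exact: (closure_bounded_eq0 fB fc _ clp).
have fw : f (u0 - p) != 0 by rewrite fB fp subr0.
move: (u0 - p) fw orth => w0 fw orth.
have w00 : dot w0 w0 != 0.
  apply: contra fw => /eqP w00; have -> : w0 = 0; last by rewrite f0.
  by apply: hnorm_eq0; apply/eqP; rewrite -sqrf_eq0 sqr_hnorm w00.
exists ((f w0 / dot w0 w0)^* *: w0) => u.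
rewrite dotZr conjCK.
have : dot w0 (f w0 *: u - f u *: w0) = 0.
  by apply: orth; rewrite /M /= fB -[_ *: u]addr0 -[_ *: w0]addr0 !fl f0; ring.
rewrite dotC => /eqP; rewrite conjC_eq0 dotBl !dotZl subr_eq0 => /eqP e.
by rewrite mulrAC e mulfK.
Qed.

(** The functional [u |-> <s u, v>] is bounded, so this is the Riesz theorem. *)
Lemma adjoint_vector (s : H -> H) v : bounded_operator s ->
  exists v', forall u, dot (s u) v = dot u v'.
Proof.
move=> /bounded_operatorP[ls [c c0 sc]].
apply: (@Riesz (fun u => dot (s u) v) (c * hnorm v)).
  by move=> a x y; rewrite ls dotZDl.
move=> u; rewrite (le_trans (CauchySchwarz _ _)) // mulrAC.
by rewrite ler_wpM2r ?hnorm_ge0.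
Qed.

End Projection.

(** * Norm estimates in C*-algebras and their representations *)

Section CStarNorm.
Context {R : realType} {A : cstarAlgType R}.
Implicit Types (x y z h : A) (a : R[i]) (S G : set A).

Definition rcnorm x : R := Re (cnorm x).

Lemma cnorm_rcnorm x : cnorm x = (rcnorm x)%:C%C.
Proof. by rewrite -ge0_ReC // cnorm_ge0. Qed.

Lemma rcnorm_ge0 x : 0 <= rcnorm x.
Proof. by rewrite ge0_Re // cnorm_ge0. Qed.

Lemma rcnormD x y : rcnorm (x + y) <= rcnorm x + rcnorm y.
Proof. by rewrite -lecR rmorphD /= -!cnorm_rcnorm ler_cnormD. Qed.

Lemma rcnormZ a x : rcnorm (a *: x) = cmod a * rcnorm x.
Proof. by apply: complexI; rewrite rmorphM /= -normc_cmod -!cnorm_rcnorm cnormZ. Qed.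

Lemma rcnormM x y : rcnorm (x * y) <= rcnorm x * rcnorm y.
Proof. by rewrite -lecR rmorphM /= -!cnorm_rcnorm ler_cnormM. Qed.

Lemma rcnormN x : rcnorm (- x) = rcnorm x.
Proof. by rewrite -scaleN1r rcnormZ cmodN cmod1 mul1r. Qed.

Lemma rcnormB x y : rcnorm (x - y) = rcnorm (y - x).
Proof. by rewrite -rcnormN opprB. Qed.

Lemma rcnorm0 : rcnorm 0 = 0.
Proof. by rewrite -(scale0r (0 : A)) rcnormZ cmod0 mul0r. Qed.

Lemma rcnorm_eq0 x : rcnorm x = 0 -> x = 0.
Proof. by move=> x0; apply: cnorm0_eq0; rewrite cnorm_rcnorm x0. Qed.

Lemma rcnorm_small_eq0 x (c : R) :
  (forall e : R, 0 < e -> rcnorm x <= c * e) -> x = 0.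
Proof.
move=> h; apply: rcnorm_eq0; have -> : rcnorm x = cmod (rcnorm x)%:C%C.
  by rewrite cmod_real ger0_norm // rcnorm_ge0.
rewrite (@cmod_small_eq0 _ (rcnorm x)%:C%C c) ?cmod0 // => e e0.
by rewrite cmod_real ger0_norm ?rcnorm_ge0 // h.
Qed.

Lemma star1 : star (1 : A) = 1.
Proof. by rewrite -[RHS]starK -[star 1 in RHS]mulr1 starM starK mulr1. Qed.

Lemma star0 : star (0 : A) = 0.
Proof. by apply: (addrI (star 0)); rewrite -starD !addr0. Qed.

Lemma starN x : star (- x) = - star x.
Proof. by rewrite -scaleN1r starZ rmorphN rmorph1 scaleN1r. Qed.

Lemma starB x y : star (x - y) = star x - star y.
Proof. by rewrite starD starN. Qed.

Lemma rcnorm_starM x : rcnorm (star x * x) = rcnorm x ^+ 2.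
Proof. by apply: complexI; rewrite rmorphXn /= -!cnorm_rcnorm cnorm_star. Qed.

Lemma rcnorm_star x : rcnorm (star x) = rcnorm x.
Proof.
have le y : rcnorm y <= rcnorm (star y).
  have := rcnorm_ge0 y; rewrite le_eqVlt => /orP[/eqP <-|y0]; first exact: rcnorm_ge0.
  by rewrite -(ler_pM2r y0) -expr2 -rcnorm_starM rcnormM.
by apply/eqP; rewrite eq_le -{2}[x]starK !le.
Qed.

Lemma entourage_rcnorm (e : R) : 0 < e ->
  entourage [set xy : A * A | rcnorm (xy.1 - xy.2) < e].
Proof.
move=> e0; apply/cnorm_entourage; exists e%:C%C; first by rewrite ltcR.
by move=> xy /=; rewrite cnorm_rcnorm ltcR.
Qed.

Lemma rcnorm_nbhs x (e : R) : 0 < e -> nbhs x [set y | rcnorm (x - y) < e].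
Proof.
move=> e0; apply/nbhsP; exists [set xy : A * A | rcnorm (xy.1 - xy.2) < e].
  exact: entourage_rcnorm.
by move=> y; rewrite /xsection /= inE.
Qed.

Lemma nbhs_rcnorm x (B : set A) : nbhs x B ->
  exists2 e : R, 0 < e & forall y, rcnorm (x - y) < e -> B y.
Proof.
move=> /nbhsP[E /cnorm_entourage[_ /ltr_posC[e e0 ->] sE] sB]; exists e => // y xy.
by apply: sB; rewrite /xsection /= inE; apply: sE; rewrite /= cnorm_rcnorm ltcR.
Qed.

Lemma cstar_closureP S x :
  closure S x <-> forall e : R, 0 < e -> exists2 y, S y & rcnorm (x - y) < e.
Proof.
split=> [cl e e0|h B /nbhs_rcnorm[e e0 sB]].
  by have [y [Sy xy]] := cl _ (rcnorm_nbhs x e0); exists y.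
by have [y Sy xy] := h e e0; exists y; split=> //; exact: sB.
Qed.

Lemma rcnorm_complete (f : nat -> A) :
  (forall e : R, 0 < e -> exists N, forall m n, (N <= m)%N -> (N <= n)%N ->
     rcnorm (f m - f n) < e) ->
  exists l, forall e : R, 0 < e ->
    exists N, forall n, (N <= n)%N -> rcnorm (f n - l) < e.
Proof.
move=> h; have cf : cauchy (f @ \oo).
  move=> E /cnorm_entourage[_ /ltr_posC[e e0 ->] sE]; have [N hN] := h e e0.
  exists (f @` [set n | (N <= n)%N], f @` [set n | (N <= n)%N]).
    by split; exists N => // n /= Nn; exists n.
  move=> [_ _] [/= [m Nm <-] [n Nn <-]]; apply: sE.
  by rewrite /= cnorm_rcnorm ltcR hN.
have [l hl] := cnorm_complete (f @ \oo) _ cf; exists l => e e0.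
have [N _ hN] := hl _ (rcnorm_nbhs l e0).
by exists N => n Nn; rewrite rcnormB; exact: hN.
Qed.

Lemma expr_small (k e : R) : 0 <= k -> k < 1 -> 0 < e -> exists N, k ^+ N < e.
Proof.
move=> k0 k1 e0; have : (fun n => k ^+ n) @ \oo --> (0 : R).
  by apply: cvg_expr; rewrite ger0_norm.
move=> /cvgrPdist_lt /(_ e e0)[N _ hN]; exists N; have := hN N (leqnn N).
by rewrite /= sub0r normrN ger0_norm // exprn_ge0.
Qed.

(** The root is [1 - y], where [y] is the fixed point of [y = (h + y ^ 2) / 2], a
    contraction of ratio [k = |h|] on the ball of radius [k]; the iterates of [0]
    are self-adjoint and so is their limit. *)
Lemma sqrt_1B h : star h = h -> rcnorm h < 1 ->
  exists2 b, star b = b & b * b = 1 - h.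
Proof.
move=> sh k1; have k0 := rcnorm_ge0 h; set k := rcnorm h in k0 k1.
pose F y : A := 2^-1 *: (h + y * y); pose f n := iter n F 0.
have half : cmod (2^-1 : R[i]) = 2^-1.
  have -> : (2^-1 : R[i]) = (2^-1 : R)%:C%C by rewrite fmorphV rmorph_nat.
  by rewrite cmod_real ger0_norm // invr_ge0.
have fk n : rcnorm (f n) <= k.
  elim: n => [|n IHn]; first by rewrite /f /= rcnorm0.
  rewrite /f iterS -/(f n) /F rcnormZ half mulrC ler_pdivrMr //.
  apply: (le_trans (rcnormD _ _)); rewrite mulr2n mulrDr mulr1 lerD //.
  apply: (le_trans (rcnormM _ _)).
  rewrite -[k in leRHS]mulr1; apply: ler_pM; rewrite ?rcnorm_ge0 //.
  exact: ltW (le_lt_trans IHn k1).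
have FB y z : rcnorm y <= k -> rcnorm z <= k -> rcnorm (F y - F z) <= k * rcnorm (y - z).
  move=> yk zk; have -> : F y - F z = 2^-1 *: (y * (y - z) + (y - z) * z).
    rewrite /F -scalerBr; congr (_ *: _).
    by rewrite mulrBr mulrBl addrA subrK opprD addrACA subrr add0r.
  rewrite rcnormZ half mulrC ler_pdivrMr //; apply: (le_trans (rcnormD _ _)).
  rewrite mulr_natr mulr2n; apply: lerD; apply: (le_trans (rcnormM _ _)).
    by rewrite ler_wpM2r ?rcnorm_ge0.
  by rewrite mulrC ler_wpM2r ?rcnorm_ge0.
(* both points are [n] contractions away from [f p] and [f 0] *)
have fC n p : rcnorm (f (n + p)%N - f n) <= k ^+ n.
  elim: n => [|n IHn]; first by rewrite /f /= subr0 -/(f p) (le_trans (fk p)) // expr0 ltW.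
  rewrite addSn /f !iterS -/(f n) -/(f (n + p)%N) exprS.
  by rewrite (le_trans (FB _ _ _ _)) // ler_wpM2l.
have [y hy] : exists y, forall e : R, 0 < e ->
    exists N, forall n, (N <= n)%N -> rcnorm (f n - y) < e.
  apply: rcnorm_complete => e e0; have e2 : 0 < e / 2 by rewrite divr_gt0.
  have [N hN] := expr_small k0 k1 e2; exists N => m n Nm Nn.
  rewrite -(subnKC Nm) -(subnKC Nn).
  set x1 := f _; set x2 := f _; have -> : x1 - x2 = (x1 - f N) - (x2 - f N).
    by rewrite opprB addrA subrK.
  apply: (le_lt_trans (rcnormD _ _)); rewrite rcnormN [e]splitr.
  by apply: ltrD; apply: le_lt_trans (fC _ _) hN.
have yk : rcnorm y <= k.
  apply/ler_addgt0Pr => e e0; have [N hN] := hy e e0.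
  have -> : y = f N + (y - f N) by rewrite addrC subrK.
  apply: (le_trans (rcnormD _ _)); rewrite lerD // rcnormB ltW // hN //.
have yF : y = F y.
  apply: subr0_eq; apply: (@rcnorm_small_eq0 _ 2) => e e0; have [N hN] := hy e e0.
  have -> : y - F y = (y - f N.+1) + (F (f N) - F y) by rewrite addrA subrK.
  apply: (le_trans (rcnormD _ _)); rewrite mulr2n mulrDl mul1r; apply: lerD.
    by rewrite rcnormB ltW // hN // leqW.
  apply: (le_trans (FB _ _ _ _)) => //; rewrite -[e]mul1r.
  by apply: ler_pM; rewrite ?rcnorm_ge0 // ltW // hN.
have sf n : star (f n) = f n.
  elim: n => [|n IHn]; first by rewrite /f /= star0.
  rewrite /f iterS -/(f n) /F starZ starD starM IHn sh.
  by rewrite fmorphV rmorph_nat.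
have sy : star y = y.
  apply: subr0_eq; apply: (@rcnorm_small_eq0 _ 2) => e e0; have [N hN] := hy e e0.
  have -> : star y - y = star (y - f N) + (f N - y) by rewrite starB sf addrA subrK.
  apply: (le_trans (rcnormD _ _)); rewrite mulr2n mulrDl mul1r; apply: lerD.
    by rewrite rcnorm_star rcnormB ltW // hN.
  by rewrite ltW // hN.
exists (1 - y); first by rewrite starB star1 sy.
have yy : y + y = h + y * y.
  rewrite {1 2}yF /F -mulr2n -scaler_nat scalerA divff ?pnatr_eq0 // scale1r //.
rewrite mulrBl mul1r mulrBr mulr1 opprB addrA addrAC -(addrA 1) -opprD yy.
by rewrite opprD addrA subrK.
Qed.

End CStarNorm.

Section RepresentationNorm.
Context {R : realType} {A : cstarAlgType R} {H : hilbertType R}.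
Context (pi : A -> H -> H) (rpi : representation pi).

Lemma representationD x y u : pi (x + y) u = pi x u + pi y u.
Proof. by case: rpi => _ l _ _ _; have := l 1 x y u; rewrite !scale1r. Qed.

Lemma representation0 u : pi 0 u = 0.
Proof. by apply: (addrI (pi 0 u)); rewrite -representationD !addr0. Qed.

Lemma representationZ a x u : pi (a *: x) u = a *: pi x u.
Proof. by case: rpi => _ l _ _ _; rewrite -[a *: x]addr0 l representation0 addr0. Qed.

Lemma representationB x y u : pi (x - y) u = pi x u - pi y u.
Proof. by rewrite representationD -scaleN1r representationZ scaleN1r. Qed.

(** For [c > |x|] the element [1 - x^* x / c ^ 2] is the square of a self-adjoint
    element, hence acts as a positive operator. *)
Lemma representation_norm x u : hnorm (pi x u) <= rcnorm x * hnorm u.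
Proof.
case: rpi => _ _ pi1 piM pistar.
suff h c : rcnorm x < c -> hnorm (pi x u) <= c * hnorm u.
  apply/ler_addgt0Pr => e e0; have u1 : 0 < hnorm u + 1 by rewrite ltr_wpDl ?hnorm_ge0.
  apply: le_trans (h (rcnorm x + e / (hnorm u + 1)) _) _.
    by rewrite ltrDl divr_gt0.
  rewrite mulrDl lerD2l mulrAC -mulrA ler_piMr ?(ltW e0) //.
  by rewrite ler_pdivrMr // mul1r lerDl.
move=> xc; have c0 : 0 < c by rewrite (le_lt_trans _ xc) ?rcnorm_ge0.
have c2 : 0 < c ^+ 2 by rewrite exprn_gt0.
pose h := ((c ^+ 2)^-1)%:C%C *: (star x * x).
have [||b sb bb] := @sqrt_1B _ _ h.
- by rewrite /h starZ starM starK conjC_real.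
- rewrite /h rcnormZ rcnorm_starM cmod_real ger0_norm ?invr_ge0 ?(ltW c2) //.
  by rewrite mulrC ltr_pdivrMr // mul1r ltrXn2r // ?nnegrE ?rcnorm_ge0 // ltW.
have := dot_ge0 (pi b u); rewrite -pistar sb -piM bb representationB pi1.
rewrite /h representationZ piM dotBl dotZl pistar !dot_hnorm -rmorphM -rmorphB /= ler0c.
rewrite subr_ge0 mulrC ler_pdivrMr // => h1.
rewrite -(@ler_pXn2r _ 2) ?nnegrE ?mulr_ge0 ?hnorm_ge0 ?(ltW c0) //.
by rewrite exprMn mulrC.
Qed.

End RepresentationNorm.

(** * Algebras generated by letters of a free product *)

Section StarSubalgebra.
Context {R : realType} {A : cstarAlgType R}.
Implicit Types (x y : A) (S G : set A).

Definition star_subalgebra S : Prop :=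
  [/\ S 1,
      forall (a : R[i]) x y, S x -> S y -> S (a *: x + y),
      forall x y, S x -> S y -> S (x * y)
    & forall x, S x -> S (star x)].

Lemma closure_star_subalgebra S : star_subalgebra S -> cstar_subalgebra (closure S).
Proof.
move=> [S1 SZD SM Sstar]; split.
- exact: closed_closure.
- exact: subset_closure.
- move=> a x y /cstar_closureP clx /cstar_closureP cly; apply/cstar_closureP => e e0.
  have a1 : 0 < cmod a + 1 by rewrite ltr_wpDl ?cmod_ge0.
  have [x' Sx' xx'] := clx (e / 2 / (cmod a + 1)) ltac:(by rewrite !divr_gt0).
  have [y' Sy' yy'] := cly (e / 2) ltac:(by rewrite divr_gt0).
  exists (a *: x' + y'); first exact: SZD.
  rewrite opprD addrACA -scalerBr (le_lt_trans (rcnormD _ _)) // [e]splitr.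
  apply: ler_ltD => //; rewrite rcnormZ; apply: le_trans (_ : (cmod a + 1) * rcnorm (x - x') <= _).
    by rewrite ler_wpM2r ?rcnorm_ge0 // lerDl.
  by rewrite mulrC -ler_pdivlMr // ltW.
- move=> x y /cstar_closureP clx /cstar_closureP cly; apply/cstar_closureP => e e0.
  have y1 : 0 < rcnorm y + 1 by rewrite ltr_wpDl ?rcnorm_ge0.
  have [x' Sx' xx'] := clx (e / 2 / (rcnorm y + 1)) ltac:(by rewrite !divr_gt0).
  have x1 : 0 < rcnorm x' + 1 by rewrite ltr_wpDl ?rcnorm_ge0.
  have [y' Sy' yy'] := cly (e / 2 / (rcnorm x' + 1)) ltac:(by rewrite !divr_gt0).
  exists (x' * y'); first exact: SM.
  have -> : x * y - x' * y' = (x - x') * y + x' * (y - y').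
    by rewrite mulrBl mulrBr addrA subrK.
  rewrite (le_lt_trans (rcnormD _ _)) // [e]splitr; apply: ler_ltD.
    apply: (le_trans (rcnormM _ _)).
    apply: le_trans (_ : rcnorm (x - x') * (rcnorm y + 1) <= _).
      by rewrite ler_wpM2l ?rcnorm_ge0 // lerDl.
    by rewrite -ler_pdivlMr // ltW.
  apply: (le_lt_trans (rcnormM _ _)).
  apply: le_lt_trans (_ : (rcnorm x' + 1) * rcnorm (y - y') < _).
    by rewrite ler_wpM2r ?rcnorm_ge0 // lerDl.
  by rewrite mulrC -ltr_pdivlMr.
- move=> x /cstar_closureP clx; apply/cstar_closureP => e e0.
  have [x' Sx' xx'] := clx e e0; exists (star x'); first exact: Sstar.
  by rewrite -starB rcnorm_star.
Qed.

Definition star_generated G : set A := smallest star_subalgebra G.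

Lemma star_generated_subalgebra G : star_subalgebra (star_generated G).
Proof.
split.
- by move=> S [[]].
- by move=> a x y Sx Sy S [SS GS]; case: (SS) => _ h _ _; apply: h; [exact: Sx|exact: Sy].
- by move=> x y Sx Sy S [SS GS]; case: (SS) => _ _ h _; apply: h; [exact: Sx|exact: Sy].
- by move=> x Sx S [SS GS]; case: (SS) => _ _ _ h; apply: h; exact: Sx.
Qed.

Lemma star_generated_sub G S : star_subalgebra S -> G `<=` S -> star_generated G `<=` S.
Proof. by move=> SS GS x; apply. Qed.

Lemma sub_star_generated G : G `<=` star_generated G.
Proof. by move=> x Gx S [_]; apply. Qed.

Lemma cstar_generated_closure G : cstar_generated G `<=` closure (star_generated G).
Proof.
move=> x; apply; split; first exact/closure_star_subalgebra/star_generated_subalgebra.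
by move=> y Gy; apply: subset_closure; exact: sub_star_generated.
Qed.

Lemma star_generated_cstar G : star_generated G `<=` cstar_generated G.
Proof. by move=> x Gx S [[_ ? ? ? ?] GS]; apply: Gx. Qed.

End StarSubalgebra.

Section StarMorphisms.
Context {R : realType}.

Lemma starhom_comp (A B C : cstarAlgType R) (f : A -> B) (g : B -> C) :
  unital_starhom f -> unital_starhom g -> unital_starhom (g \o f).
Proof.
move=> [fl f1 fM fs] [gl g1 gM gs]; split => [a x y|/=|x y /=|x /=].
- by rewrite /= fl gl.
- by rewrite f1 g1.
- by rewrite fM gM.
- by rewrite fs gs.
Qed.

Lemma starhom_id (A : cstarAlgType R) : unital_starhom (@id A).
Proof. by split. Qed.

Lemma starhom_iter (A : cstarAlgType R) (f : A -> A) n :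
  unital_starhom f -> unital_starhom (iter n f).
Proof.
move=> fh; elim: n => [|n IHn]; first exact: starhom_id.
exact: (starhom_comp IHn fh).
Qed.

Lemma representation_comp (A B : cstarAlgType R) (H : hilbertType R)
    (f : A -> B) (pi : B -> H -> H) :
  unital_starhom f -> representation pi -> representation (fun x => pi (f x)).
Proof.
move=> [fl f1 fM fs] [pb pl p1 pM ps]; split=> [x|a x y u|u|x y u|x u v].
- exact: pb.
- by rewrite fl pl.
- by rewrite f1 p1.
- by rewrite fM pM.
- by rewrite fs ps.
Qed.

Lemma starhom_preim (A B : cstarAlgType R) (f : A -> B) (S : set B) :
  unital_starhom f -> star_subalgebra S -> star_subalgebra (f @^-1` S).
Proof.
move=> [fl f1 fM fs] [S1 SZD SM Ss]; split => [|a x y Sx Sy|x y Sx Sy|x Sx] /=.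
- by rewrite f1.
- by rewrite fl; exact: SZD.
- by rewrite fM; exact: SM.
- by rewrite fs; exact: Ss.
Qed.

Lemma starhom_eq_subalgebra (A B : cstarAlgType R) (f g : A -> B) :
  unital_starhom f -> unital_starhom g -> star_subalgebra [set x | f x = g x].
Proof.
move=> [fl f1 fM fs] [gl g1 gM gs]; split => [|a x y /= fx fy|x y /= fx fy|x /= fx] /=.
- by rewrite f1 g1.
- by rewrite fl gl fx fy.
- by rewrite fM gM fx fy.
- by rewrite fs gs fx.
Qed.

Lemma starhom_image_subalgebra (A B : cstarAlgType R) (f : A -> B) (S : set A) :
  unital_starhom f -> star_subalgebra S -> star_subalgebra (f @` S).
Proof.
move=> [fl f1 fM fs] [S1 SZD SM Ss]; split.
- by exists 1.
- by move=> a _ _ [x Sx <-] [y Sy <-]; exists (a *: x + y); rewrite ?fl //; exact: SZD.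
- by move=> _ _ [x Sx <-] [y Sy <-]; exists (x * y); rewrite ?fM //; exact: SM.
- by move=> _ [x Sx <-]; exists (star x); rewrite ?fs //; exact: Ss.
Qed.

End StarMorphisms.

Section FreeProductAlgebra.
Context {R : realType} {A : cstarAlgType R}.

(** The *-algebra generated by the copies of [A] with index in [F], without
    closing it.  Maps of the index set act on these algebras by pure algebra,
    whereas on the C*-algebras generated by the copies one would first have to
    know that *-homomorphisms are continuous. *)
Definition word_algebra (J : Type) (P : freeProduct J A) (F : set J) : set P :=
  star_generated (\bigcup_(j in F) range (fp_emb P j)).

Arguments word_algebra {J} P F _.

Section OneIndexSet.
Context {J : Type} (P : freeProduct J A).
Implicit Types (F G : set J) (x y z : P).

Lemma word_subalgebra F : star_subalgebra (word_algebra P F).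
Proof. exact: star_generated_subalgebra. Qed.

Lemma word_emb F j a : F j -> word_algebra P F (fp_emb P j a).
Proof. by move=> Fj; apply: sub_star_generated; exists j => //; exists a. Qed.

Lemma word_ind F (S : set P) : star_subalgebra S ->
  (forall j a, F j -> S (fp_emb P j a)) -> word_algebra P F `<=` S.
Proof.
by move=> SS h; apply: star_generated_sub => // _ [j Fj [a _ <-]]; exact: h.
Qed.

Lemma wordS F G : F `<=` G -> word_algebra P F `<=` word_algebra P G.
Proof.
move=> FG; apply: word_ind; first exact: word_subalgebra.
by move=> j a /FG; exact: word_emb.
Qed.

Lemma word_mul F x y : word_algebra P F x -> word_algebra P F y -> word_algebra P F (x * y).
Proof. by case: (word_subalgebra F) => _ _ h _; exact: h. Qed.

Lemma word_star F x : word_algebra P F x -> word_algebra P F (star x).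
Proof. by case: (word_subalgebra F) => _ _ _ h; exact: h. Qed.

Lemma word_dense : closure (word_algebra P setT) = setT.
Proof.
apply/seteqP; split=> // x _; apply: cstar_generated_closure.
by rewrite fp_generated.
Qed.

(** An element of a word algebra involves finitely many letters, so it already lies
    in one member of any increasing family that exhausts the indices. *)
Lemma word_exhaust (I : nat -> set J) F x :
  (forall m n, (m <= n)%N -> I m `<=` I n) -> (forall j, F j -> exists n, I n j) ->
  word_algebra P F x -> exists n, word_algebra P (I n) x.
Proof.
move=> Imono Icov; move: x; apply: word_ind; last first.
  by move=> j a Fj; have [n Inj] := Icov j Fj; exists n; exact: word_emb.
have up m n x : (m <= n)%N -> word_algebra P (I m) x -> word_algebra P (I n) x.
  by move=> mn; exact: wordS (Imono _ _ mn) x.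
split.
- by exists 0; case: (word_subalgebra (I 0)).
- move=> a x y [m xm] [n yn]; exists (maxn m n).
  case: (word_subalgebra (I (maxn m n))) => _ h _ _.
  by apply: h; [apply: up xm; exact: leq_maxl|apply: up yn; exact: leq_maxr].
- move=> x y [m xm] [n yn]; exists (maxn m n).
  by apply: word_mul; [apply: up xm; exact: leq_maxl|apply: up yn; exact: leq_maxr].
- by move=> x [m xm]; exists m; exact: word_star.
Qed.

Lemma starhom_word_eq (B : cstarAlgType R) (f g : P -> B) F :
  unital_starhom f -> unital_starhom g ->
  (forall j a, F j -> f (fp_emb P j a) = g (fp_emb P j a)) ->
  forall x, word_algebra P F x -> f x = g x.
Proof.
by move=> fh gh fg; apply: word_ind; first exact: starhom_eq_subalgebra.
Qed.

End OneIndexSet.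

Section Maps.
Context {J K : Type} (P : freeProduct J A) (Q : freeProduct K A).

Lemma fp_map_starhom (f : J -> K) : unital_starhom (fp_map (P := P) Q f).
Proof. by rewrite /fp_map; case: cid => F []. Qed.

Lemma fp_map_emb (f : J -> K) j a : fp_map (P := P) Q f (fp_emb P j a) = fp_emb Q (f j) a.
Proof. by rewrite /fp_map; case: cid => F []. Qed.

Lemma starhom_word (f : P -> Q) (s : J -> K) (F : set J) (G : set K) :
  unital_starhom f -> (forall j a, F j -> f (fp_emb P j a) = fp_emb Q (s j) a) ->
  (forall j, F j -> G (s j)) ->
  forall x, word_algebra P F x -> word_algebra Q G (f x).
Proof.
move=> fh fe FG; apply: word_ind.
  by apply: starhom_preim => //; exact: word_subalgebra.
by move=> j a Fj /=; rewrite fe //; apply: word_emb; exact: FG.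
Qed.

End Maps.

Lemma localized_closure (P : freeProduct nat A) (F : set nat) (x : P) :
  localized F x -> closure (word_algebra P F) x.
Proof. exact: cstar_generated_closure. Qed.

Lemma word_localized (P : freeProduct nat A) (F : set nat) (x : P) :
  word_algebra P F x -> localized F x.
Proof. exact: star_generated_cstar. Qed.

Lemma shiftN_starhom (P : freeProduct nat A) n : unital_starhom (iter n (fp_shiftN P)).
Proof. by apply: starhom_iter; exact: fp_map_starhom. Qed.

Lemma shiftN_emb (P : freeProduct nat A) n j a :
  iter n (fp_shiftN P) (fp_emb P j a) = fp_emb P (j + n)%N a.
Proof.
elim: n => [|n IHn]; first by rewrite addn0.
by rewrite iterS IHn /fp_shiftN /fp_alpha fp_map_emb addnS.
Qed.

Lemma shiftN_word (P : freeProduct nat A) n (F G : set nat) x :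
  (forall j, F j -> G (j + n)%N) ->
  word_algebra P F x -> word_algebra P G (iter n (fp_shiftN P) x).
Proof.
move=> FG; apply: (starhom_word (shiftN_starhom P n) (s := fun j => (j + n)%N)) => //.
by move=> j a _; exact: shiftN_emb.
Qed.

Lemma shiftZ_starhom (Q : freeProduct int A) n : unital_starhom (iter n (fp_shiftZ Q)).
Proof. by apply: starhom_iter; exact: fp_map_starhom. Qed.

Lemma shiftZ_emb (Q : freeProduct int A) n j a :
  iter n (fp_shiftZ Q) (fp_emb Q j a) = fp_emb Q (j + n%:Z) a.
Proof.
elim: n => [|n IHn]; first by rewrite addr0.
by rewrite iterS IHn /fp_shiftZ /fp_alpha fp_map_emb -addrA intS [1 + _]addrC.
Qed.

End FreeProductAlgebra.

Arguments word_algebra {R A J} P F _.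

(** * Bounded operators *)

Section BoundedOperators.
Context {R : realType} {H : hilbertType R}.
Implicit Types (u v w : H) (a c : R[i]) (M : set H) (T s : H -> H).

Lemma bounded_operatorZD T a u v : bounded_operator T -> T (a *: u + v) = a *: T u + T v.
Proof. by case=> l _; rewrite l. Qed.

Lemma bounded_operatorD T u v : bounded_operator T -> T (u + v) = T u + T v.
Proof. by move=> bT; rewrite -[u in LHS]scale1r bounded_operatorZD // scale1r. Qed.

Lemma bounded_operator0 T : bounded_operator T -> T 0 = 0.
Proof. by move=> bT; apply: (addrI (T 0)); rewrite -bounded_operatorD // !addr0. Qed.

Lemma bounded_operatorZ T a u : bounded_operator T -> T (a *: u) = a *: T u.
Proof. by move=> bT; rewrite -[a *: u]addr0 bounded_operatorZD // bounded_operator0 // addr0. Qed.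

Lemma bounded_operatorB T u v : bounded_operator T -> T (u - v) = T u - T v.
Proof. by move=> bT; rewrite bounded_operatorD // -scaleN1r bounded_operatorZ // scaleN1r. Qed.

Lemma bounded_operator_closure T M N u : bounded_operator T ->
  (forall m, M m -> N (T m)) -> closure M u -> closure N (T u).
Proof.
move=> bT MN; have [_ [c c0 Tc]] := (bounded_operatorP _).1 bT.
move=> /closureP cl; apply/closureP => e e0.
have c1 : 0 < c + 1 by rewrite ltr_wpDl.
have [m Mm um] := cl (e / (c + 1)) ltac:(by rewrite divr_gt0).
exists (T m); first exact: MN.
rewrite -bounded_operatorB // (le_lt_trans (Tc _)) //.
apply: le_lt_trans (_ : (c + 1) * hnorm (u - m) < _).
  by rewrite ler_wpM2r ?hnorm_ge0 // lerDl.
by rewrite mulrC -ltr_pdivlMr.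
Qed.

Lemma scale_operator c : bounded_operator (fun u => c *: u).
Proof.
apply/bounded_operatorP; split; first by move=> a u v; rewrite scalerDr !scalerA mulrC.
by exists (cmod c); [exact: cmod_ge0|move=> u; rewrite hnormZ].
Qed.

Lemma bounded_operator_closure_eq T T' M u : bounded_operator T -> bounded_operator T' ->
  (forall m, M m -> T m = T' m) -> closure M u -> T u = T' u.
Proof.
move=> bT bT' TT' clu; apply: dot_extr => w.
have [v hv] := adjoint_vector w bT; have [v' hv'] := adjoint_vector w bT'.
rewrite hv hv'; apply/eqP; rewrite -subr_eq0 -dotBr; apply/eqP.
by apply: dot_closure0 clu => m Mm; rewrite dotBr -hv -hv' TT' // subrr.
Qed.

Lemma closure_subspace M : subspace M -> subspace (closure M).
Proof.
move=> [M0 MZD]; split; first exact: subset_closure.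
move=> a u v clu clv; apply/closureP => e e0; have e2 : 0 < e / 2 by rewrite divr_gt0.
have /closureP /(_ _ e2) [_ [u' Mu' <-] uu'] :
    closure [set a *: u | u in M] (a *: u).
  by apply: bounded_operator_closure clu; [exact: scale_operator|move=> m Mm; exists m].
have /closureP /(_ _ e2) [v' Mv' vv'] := clv.
exists (a *: u' + v'); first exact: MZD.
by rewrite opprD addrACA (le_lt_trans (hnormD _ _)) // [e]splitr ltrD.
Qed.

(** The commutation property is what makes projections useful for commutants: an
    operator that preserves [M] together with its adjoint also preserves the
    orthogonal complement of [M]. *)
Lemma projection_operator M : subspace M ->
  exists p, [/\ bounded_operator p,
    forall u, closure M (p u),
    forall u, M u -> p u = u
  & forall s s' : H -> H, bounded_operator s ->
      (forall u v, dot (s u) v = dot u (s' v)) ->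
      (forall m, M m -> M (s m)) -> (forall m, M m -> M (s' m)) ->
      p \o s = s \o p].
Proof.
move=> sM; have [p hp] := choice (fun u => projection u sM); exists p.
have clp u : closure M (p u) by have [] := hp u.
have orth u m : M m -> dot (u - p u) m = 0 by have [_] := hp u; apply.
have clsM := closure_subspace sM.
have orthcl u w : closure M w -> dot (u - p u) w = 0.
  move=> clw; rewrite dotC (dot_closure0 _ clw) ?rmorph0 // => m Mm.
  by rewrite dotC orth // rmorph0.
have uniq u q : closure M q -> (forall m, M m -> dot (u - q) m = 0) -> p u = q.
  move=> clq orthq; apply: subr0_eq; apply: hnorm_eq0; apply/eqP.
  have cld : closure M (p u - q).
    by rewrite addrC -scaleN1r; exact: clsM.2.
  have dq : dot (u - q) (p u - q) = 0.
    rewrite dotC (dot_closure0 _ cld) ?rmorph0 // => m Mm.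
    by rewrite dotC orthq // rmorph0.
  rewrite -sqrf_eq0 sqr_hnorm.
  have {1}-> : p u - q = (u - q) - (u - p u) by rewrite opprB [RHS]addrC addrA subrK.
  by rewrite dotBl dq orthcl // subr0.
have pl : linear p.
  move=> a u v; apply: uniq; first by apply: clsM.2.
  move=> m Mm; have -> : a *: u + v - (a *: p u + p v) = a *: (u - p u) + (v - p v).
    by rewrite scalerBr opprD addrACA.
  by rewrite dotZDl !orth // mulr0 addr0.
split=> //.
- apply/bounded_operatorP; split=> //; exists 1 => // u; rewrite mul1r.
  rewrite -(@ler_pXn2r _ 2) ?nnegrE ?hnorm_ge0 //.
  rewrite -{2}[u](subrK (p u)) sqr_hnormD orthcl // mulr0 addr0.
  by rewrite lerDr sqr_ge0.
- by move=> u Mu; apply: uniq; [exact: subset_closure|rewrite subrr => m _; rewrite dot0l].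
- move=> s s' bs adj sM1 sM2; apply/funext => u /=; apply: uniq.
    exact: bounded_operator_closure bs sM1 (clp u).
  by move=> m Mm; rewrite -bounded_operatorB // adj orth //; exact: sM2.
Qed.

(** The eigenvalues of [u0], [v] and [u0 + v] coincide unless [u0] and [v] are
    proportional, in which case linearity says the same. *)
Lemma eigenvectors_scalar M T : subspace M -> closure M = setT -> bounded_operator T ->
  (forall u, M u -> exists c, T u = c *: u) -> exists c, T = (fun u => c *: u).
Proof.
move=> sM dM bT eig; suff [c hc] : exists c, forall u, M u -> T u = c *: u.
  exists c; apply/funext => u.
  apply: (bounded_operator_closure_eq bT (scale_operator c) hc).
  by rewrite dM.
have [M0|/existsNP[u0 /not_implyP[Mu0 /eqP u00]]] := pselect (forall u, M u -> u = 0).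
  by exists 0 => u /M0 ->; rewrite bounded_operator0 // scaler0.
have [c hc] := eig u0 Mu0; exists c => v Mv; have [d hd] := eig v Mv.
have [b] := eig _ (subspaceD sM Mu0 Mv).
rewrite bounded_operatorD // hc hd scalerDr => /eqP.
rewrite -subr_eq0 opprD addrACA -!scalerBl => /eqP e.
have [db|db] := eqVneq d b.
  move: e; rewrite db subrr scale0r addr0 => /eqP.
  by rewrite scaler_eq0 (negPf u00) orbF subr_eq0 => /eqP ->.
have vE : v = - ((c - b) / (d - b)) *: u0.
  have /eqP := e; rewrite addrC addr_eq0 => /eqP e'.
  rewrite -[v]scale1r -(mulVf (_ : d - b != 0)) ?subr_eq0 // -scalerA e'.
  by rewrite scalerN scalerA scaleNr mulrC.
by rewrite -hd vE bounded_operatorZ // hc scalerA mulrC -scalerA.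
Qed.

End BoundedOperators.

(** * Limits along an ultrafilter *)

Section UltraLimit.
Context {R : realType} (U : set_system nat) (UU : UltraFilter U).
Implicit Types (f g : nat -> R[i]) (a b l : R[i]).

Definition ultralimit f l : Prop :=
  forall e : R, 0 < e -> U [set n | cmod (f n - l) < e].

Let UF : ProperFilter U. Proof. exact: ultra_proper. Qed.

Lemma ultralimit_uniq f a b : ultralimit f a -> ultralimit f b -> a = b.
Proof.
move=> fa fb; apply: subr0_eq; apply: (@cmod_small_eq0 _ _ 2) => e e0.
have [n [na nb]] := filter_ex (filterI (fa e e0) (fb e e0)).
have -> : a - b = (f n - b) - (f n - a) by rewrite opprB [RHS]addrC addrA subrK.
rewrite (le_trans (cmodD _ _)) // cmodN mulr2n mulrDl mul1r.
by apply: lerD; apply: ltW.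
Qed.

Lemma ultralimit_cst a : ultralimit (fun=> a) a.
Proof. by move=> e e0; apply: filterE => n /=; rewrite subrr cmod0. Qed.

Lemma ultralimitZD f g a l l' : ultralimit f l -> ultralimit g l' ->
  ultralimit (fun n => a * f n + g n) (a * l + l').
Proof.
move=> fl gl e e0; have a1 : 0 < cmod a + 1 by rewrite ltr_wpDl ?cmod_ge0.
have e2 : 0 < e / 2 by rewrite divr_gt0.
have e3 : 0 < e / 2 / (cmod a + 1) by rewrite divr_gt0.
apply: filterS (filterI (fl _ e3) (gl _ e2)) => n [/= h1 h2].
have -> : a * f n + g n - (a * l + l') = a * (f n - l) + (g n - l') by ring.
rewrite (le_lt_trans (cmodD _ _)) // [e]splitr ler_ltD // cmodM.
apply: le_trans (_ : (cmod a + 1) * cmod (f n - l) <= _).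
  by rewrite ler_wpM2r ?cmod_ge0 // lerDl.
by rewrite mulrC -ler_pdivlMr // ltW.
Qed.

Lemma ultralimit_near f g l : (\forall n \near \oo, f n = g n) -> \oo `<=` U ->
  ultralimit f l -> ultralimit g l.
Proof.
by move=> /[swap] oU /oU fg fl e e0; apply: filterS (filterI fg (fl e e0)) => n [/= ->].
Qed.

Lemma ultralimit_le f l (c : R) : (forall n, cmod (f n) <= c) -> ultralimit f l -> cmod l <= c.
Proof.
move=> fc fl; apply/ler_addgt0Pr => e e0; have [n hn] := filter_ex (fl e e0).
have -> : l = f n - (f n - l) by rewrite opprB addrC subrK.
by rewrite (le_trans (cmodD _ _)) // lerD // cmodN ltW.
Qed.

(** By compactness the image filter has a cluster point, and an ultrafilter converges
    to its cluster points. *)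
Lemma real_ultralimit (f : nat -> R) (c : R) : (forall n, `|f n| <= c) ->
  exists l : R, forall e : R, 0 < e -> U [set n | `|f n - l| < e].
Proof.
move=> fc; have := @segment_compact R (- c) c; rewrite /compact => cpt.
have [|l [_ cl]] := cpt (f @ U) _.
  by apply: (@filterE _ U) => n /=; rewrite in_itv /= -ler_norml.
exists l => e e0; have [//|Un] := in_ultra_setVsetC [set n | `|f n - l| < e] UU.
have Ue : U [set n | e <= `|f n - l|].
  by apply: filterS Un => n /= h; rewrite leNgt; exact/negP.
have [x [/= hx1 hx2]] := cl [set x : R | e <= `|x - l|] _ Ue (nbhsx_ballx (l : R) e e0).
by move: hx2; rewrite /ball /= distrC ltNge hx1.
Qed.

Lemma bounded_ultralimit f (c : R) : (forall n, cmod (f n) <= c) -> exists l, ultralimit f l.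
Proof.
move=> fc.
have [x hx] := real_ultralimit (fun n => le_trans (Re_le_cmod (f n)) (fc n)).
have [y hy] := real_ultralimit (fun n => le_trans (Im_le_cmod (f n)) (fc n)).
exists (x +i* y)%C => e e0; have e2 : 0 < e / 2 by rewrite divr_gt0.
apply: filterS (filterI (hx _ e2) (hy _ e2)) => n [/= h1 h2].
rewrite (le_lt_trans (cmod_le_ReIm _)) // [e]splitr.
by move: h1 h2; case: (f n) => a b /= h1 h2; exact: ltrD.
Qed.

End UltraLimit.

(** * The dense orbit of the cyclic vector *)

Section GNSVectors.
Context {R : realType} {B : cstarAlgType R} {H : hilbertType R}.
Context (phi : B -> R[i]) (pi : B -> H -> H) (xi : H).
Context (gns : is_GNS phi pi xi).
Implicit Types (x y z w : B) (W : set B).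

Let rpi : representation pi. Proof. by case: gns. Qed.

Definition orbit W : set H := [set pi x xi | x in W].

Lemma GNS_dot x z w : dot (pi x (pi z xi)) (pi w xi) = phi (star w * x * z).
Proof.
case: gns => [[_ _ _ piM pistar] _ ->].
by rewrite -mulrA (piM (star w)) pistar piM.
Qed.

Lemma GNS_dot2 z w : dot (pi z xi) (pi w xi) = phi (star w * z).
Proof. by have := GNS_dot 1 z w; case: rpi => _ _ -> _ _; rewrite mulr1. Qed.

Lemma GNS_bounded x : phi 1 = 1 -> cmod (phi x) <= rcnorm x.
Proof.
case: (gns) => _ _ phiE phi1.
have nxi : hnorm xi = 1.
  apply/eqP; rewrite -(@eqrXn2 _ 2) ?hnorm_ge0 // expr1n sqr_hnorm.
  by case: (rpi) => _ _ pi1 _ _; have := phiE 1; rewrite phi1 pi1 => <-.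
rewrite phiE (le_trans (CauchySchwarz _ _)) // nxi mulr1.
by rewrite (le_trans (representation_norm rpi _ _)) // nxi mulr1.
Qed.

Lemma orbit_subspace W : star_subalgebra W -> subspace (orbit W).
Proof.
move=> [W1 WZD WM Ws]; split; last first.
  move=> a _ _ [x Wx <-] [y Wy <-]; exists (a *: x + y); first exact: WZD.
  by case: rpi => _ -> _ _ _.
exists (-1 *: 1 + 1); first exact: WZD.
by rewrite scaleN1r addNr (representation0 rpi).
Qed.

Lemma orbit_dense W : closure W = setT -> closure (orbit W) = setT.
Proof.
move=> dW; apply/seteqP; split=> // u _; apply/closureP => e e0.
have e2 : 0 < e / 2 by rewrite divr_gt0.
have n1 : 0 < hnorm xi + 1 by rewrite ltr_wpDl ?hnorm_ge0.
have : closure (range (fun x => pi x xi)) u by case: gns => _ -> _.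
move=> /closureP /(_ _ e2) [_ [x _ <-] ux].
have : closure W x by rewrite dW.
move=> /cstar_closureP /(_ (e / 2 / (hnorm xi + 1))) [|y Wy xy]; first by rewrite divr_gt0.
exists (pi y xi); first by exists y.
have -> : u - pi y xi = (u - pi x xi) + pi (x - y) xi.
  by rewrite (representationB rpi) addrA subrK.
rewrite (le_lt_trans (hnormD _ _)) // [e]splitr ltr_leD //.
rewrite (le_trans (representation_norm rpi _ _)) //.
apply: le_trans (_ : rcnorm (x - y) * (hnorm xi + 1) <= _).
  by rewrite ler_wpM2l ?rcnorm_ge0 // lerDl.
by rewrite -ler_pdivlMr // ltW.
Qed.

End GNSVectors.

Section Density.
Context {R : realType} {B : cstarAlgType R}.

Lemma closure_functional_eq0 (S : set B) (g : B -> R[i]) (c : R) x :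
  (forall x y, g (x - y) = g x - g y) -> (forall x, cmod (g x) <= c * rcnorm x) ->
  (forall y, S y -> g y = 0) -> closure S x -> g x = 0.
Proof.
move=> gB gc gS /cstar_closureP cl; apply: (@cmod_small_eq0 _ _ `|c|) => e e0.
have [y Sy xy] := cl e e0.
have -> : g x = g (x - y) by rewrite gB (gS y) // subr0.
rewrite (le_trans (gc _)) // (le_trans (ler_wpM2r (rcnorm_ge0 _) (ler_norm c))) //.
by rewrite ler_wpM2l // ltW.
Qed.

(** For two fixed variables both sides are bounded linear functionals of the third, so
    the closures can be reached one variable at a time. *)
Lemma factorization_closure (phi : B -> R[i]) (Sx Sy Sz : set B) :
  scalar phi -> (forall x, cmod (phi x) <= rcnorm x) ->
  (forall x y z, Sx x -> Sy y -> Sz z -> phi (x * y * z) = phi (x * z) * phi y) ->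
  forall x y z, closure Sx x -> closure Sy y -> closure Sz z ->
    phi (x * y * z) = phi (x * z) * phi y.
Proof.
move=> phil phib h.
have phiB x y : phi (x - y) = phi x - phi y.
  by rewrite addrC -scaleN1r phil mulN1r addrC.
have bound x y z : cmod (phi (x * y * z) - phi (x * z) * phi y) <=
    2 * (rcnorm x * rcnorm y * rcnorm z).
  rewrite (le_trans (cmodD _ _)) // cmodN cmodM mulr2n mulrDl mul1r; apply: lerD.
    rewrite (le_trans (phib _)) // (le_trans (rcnormM _ _)) //.
    by rewrite ler_wpM2r ?rcnorm_ge0 // rcnormM.
  rewrite mulrAC; apply: ler_pM; rewrite ?cmod_ge0 //.
  by rewrite (le_trans (phib _)) // rcnormM.
have h1 x y z : closure Sx x -> Sy y -> Sz z -> phi (x * y * z) - phi (x * z) * phi y = 0.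
  move=> clx Syy Szz.
  apply: (@closure_functional_eq0 Sx (fun x => phi (x * y * z) - phi (x * z) * phi y)
    (2 * (rcnorm y * rcnorm z))) clx => [u v|u|u Su].
  - by rewrite !mulrBl !phiB; ring.
  - by apply: (le_trans (bound _ _ _)); rewrite -!mulrA (mulrC (rcnorm u)) !mulrA.
  - by rewrite h // subrr.
have h2 x y z : closure Sx x -> closure Sy y -> Sz z ->
    phi (x * y * z) - phi (x * z) * phi y = 0.
  move=> clx cly Szz.
  apply: (@closure_functional_eq0 Sy (fun y => phi (x * y * z) - phi (x * z) * phi y)
    (2 * (rcnorm x * rcnorm z))) cly => [u v|u|u Su].
  - by rewrite mulrBr !mulrBl !phiB; ring.
  - by apply: (le_trans (bound _ _ _)); rewrite -!mulrA (mulrC (rcnorm u)) !mulrA.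
  - exact: h1.
move=> x y z clx cly clz; apply: subr0_eq.
apply: (@closure_functional_eq0 Sz (fun z => phi (x * y * z) - phi (x * z) * phi y)
    (2 * (rcnorm x * rcnorm y))) clz => [u v|u|u Su].
- by rewrite !mulrBr !phiB; ring.
- by apply: (le_trans (bound _ _ _)); rewrite -!mulrA.
- exact: h2.
Qed.

End Density.

(** * Decoupling makes the tail algebra trivial *)

Section Positions.
Context {R : realType} {A : cstarAlgType R} (P : freeProduct nat A).

Definition below (m : nat) : set nat := [set k | (k < m)%N].
Definition above (m : nat) : set nat := [set k | (m <= k)%N].

Lemma finite_below m : finite_set (below m).
Proof. by apply: (@sub_finite_set _ _ `I_m) => //; exact: finite_II. Qed.

Lemma finite_set_below (F : set nat) : finite_set F -> exists m, F `<=` below m.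
Proof.
move=> /finite_seqP[s ->]; exists (\max_(i <- s) i).+1 => k ks.
by rewrite /below /= ltnS; apply: leq_bigmax_seq.
Qed.

Lemma below_subset m n : (m <= n)%N -> below m `<=` below n.
Proof. by move=> mn k /= km; exact: leq_trans mn. Qed.

Lemma word_below x : word_algebra P setT x -> exists m, word_algebra P (below m) x.
Proof.
apply: word_exhaust => [m n mn k /= km|k _]; first exact: leq_trans mn.
by exists k.+1; exact: ltnSn.
Qed.

(** The algebraic core of forward decoupling: two complementary ranges of indices
    replace the finite supports, and no closure is involved. *)
Definition word_decoupling (phi : P -> R[i]) : Prop := forall m x y z,
  word_algebra P (below m) x -> word_algebra P (above m) y ->
  word_algebra P (below m) z -> phi (x * y * z) = phi (x * z) * phi y.

End Positions.

Section TailAlgebra.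
Context {R : realType} {A : cstarAlgType R} (P : freeProduct nat A).
Context (phi : P -> R[i]) (phi_state : is_state phi).
Context {H : hilbertType R} (pi : P -> H -> H) (xi : H) (gns : is_GNS phi pi xi).

Let rpi : representation pi. Proof. by case: gns. Qed.

(** In one direction an element involves finitely many letters; in the other the
    factorization extends to closures because a state is bounded. *)
Lemma forward_decouplingP : forward_decoupling phi <-> word_decoupling phi.
Proof.
split=> [fd m x y z wx wy wz|wd Fx Fy Fz x y z fx fy fz lx ly lz far].
  have [n wyn] : exists n, word_algebra P (above m `&` below n) y.
    apply: word_exhaust wy => [n n' nn' k [/= mk kn]|k /= mk].
      by split=> //=; exact: leq_trans nn'.
    by exists k.+1; split=> //; exact: ltnSn.
  apply: (fd (below m) (above m `&` below n) (below m)).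
  - exact: finite_below.
  - by apply: sub_finite_set (finite_below n) => k [].
  - exact: finite_below.
  - exact: word_localized.
  - exact: word_localized.
  - exact: word_localized.
  - by move=> j k [/= mj _] [/= km|/= km]; exact: leq_trans mj.
have [m0 Fm0] : exists m, Fx `|` Fz `<=` below m.
  by apply: finite_set_below; rewrite finite_setU.
have ex : exists m, `[< Fx `|` Fz `<=` below m >] by exists m0; exact/asboolP.
(* by minimality of [m], the support of [y] starts at [m] at the earliest *)
have [m /asboolP Fm min] := ex_minnP ex.
have Fym : Fy `<=` above m.
  move=> j Fj; rewrite /above /= leqNgt; apply/negP => jm.
  have mj : (m <= j)%N by apply: min; apply/asboolP => k Fk; exact: (far j k).
  by move: jm; rewrite ltnNge mj.
have := @factorization_closure _ _ phi (word_algebra P Fx) (word_algebra P Fy)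
  (word_algebra P Fz); apply=> //; last 3 first.
- exact: localized_closure.
- exact: localized_closure.
- exact: localized_closure.
- by case: phi_state.
- by move=> w; apply: (GNS_bounded gns); case: phi_state.
move=> u v w wu wv ww; apply: (wd m).
- by apply: wordS wu => k Fk; apply: Fm; left.
- exact: wordS wv.
- by apply: wordS ww => k Fk; apply: Fm; right.
Qed.

Definition letters_from (n : nat) : set (H -> H) :=
  [set T | exists k a, (n <= k)%N /\ T = pi (fp_emb P k a)].

Lemma scalar_operators_tail : scalar_operators `<=` tail_algebra pi.
Proof.
move=> _ [c ->] n _; split; first exact: scale_operator.
by move=> s [bs _]; apply/funext => u /=; rewrite bounded_operatorZ.
Qed.

(** Elements that commute with [s] need not form a *-algebra; those which do so
    together with their adjoints do, and the letters are among them. *)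
Lemma commutant_word n s y : commutant (letters_from n) s ->
  word_algebra P (above n) y -> forall u, s (pi y u) = pi y (s u).
Proof.
move=> [bs cs]; case: (rpi) => _ pl p1 pM _.
suff h : word_algebra P (above n) `<=` [set y |
    (forall u, s (pi y u) = pi y (s u)) /\
    (forall u, s (pi (star y) u) = pi (star y) (s u))].
  by move=> /h[].
apply: word_ind.
  split.
  - by rewrite /= star1; split=> u; rewrite !p1.
  - move=> a x z [x1 x2] [z1 z2]; rewrite /= starD starZ.
    by split=> u; rewrite !pl bounded_operatorZD // ?x1 ?z1 ?x2 ?z2.
  - move=> x z [x1 x2] [z1 z2]; rewrite /= starM.
    by split=> u; rewrite !pM ?x1 ?z1 ?z2 ?x2.
  - by move=> x [x1 x2]; rewrite /= starK.
move=> k a nk; have emb b u : s (pi (fp_emb P k b) u) = pi (fp_emb P k b) (s u).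
  have /cs/funeqP/(_ u) // : letters_from n (pi (fp_emb P k b)) by exists k, b.
split=> // u; case: (fp_emb_starhom P k) => _ _ _ <-; exact: emb.
Qed.

(** The bicommutant theorem for a single vector: an operator of the tail algebra
    maps [u] into the closure of the orbit of [u] under the elements supported
    far away, because it commutes with the projection on that closure. *)
Lemma tail_orbit n T u : tail_algebra pi T ->
  closure [set pi y u | y in word_algebra P (above n)] (T u).
Proof.
move=> tT; have [bT cT] := tT n I.
set M := [set pi y u | y in _].
case: (rpi) => pb pl p1 pM ps.
case: (word_subalgebra P (above n)) => W1 WZD WM Ws.
have Mu : M u by exists 1; rewrite ?p1.
have sM : subspace M.
  split; last by move=> a _ _ [x Wx <-] [y Wy <-]; exists (a *: x + y); rewrite ?pl //; exact: WZD.
  exists (-1 *: 1 + 1); first exact: WZD.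
  by rewrite scaleN1r addNr (representation0 rpi).
have [p [bp clp pM1 pcomm]] := projection_operator sM.
have cp : commutant (letters_from n) p.
  split=> // _ [k [a [nk ->]]].
  apply: (pcomm _ (pi (fp_emb P k (star a)))) => //.
  - move=> v w; rewrite -ps; congr dot; congr (pi _ v).
    by case: (fp_emb_starhom P k) => _ _ _ <-; rewrite starK.
  - move=> _ [y Wy <-]; exists (fp_emb P k a * y); last exact: pM.
    by apply: WM => //; exact: word_emb.
  - move=> _ [y Wy <-]; exists (fp_emb P k (star a) * y); last exact: pM.
    by apply: WM => //; exact: word_emb.
by have /funeqP/(_ u) /= := cT p cp; rewrite (pM1 u Mu) => ->; exact: clp.
Qed.

(** Under decoupling, elements [y] supported far away satisfy
    [<y u, v> = phi y <u, v>] for [u], [v] in the dense orbit; hence tail operators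
    have all these [u] as eigenvectors. *)
Lemma decoupling_tail : word_decoupling phi -> tail_algebra pi = scalar_operators.
Proof.
move=> wd; apply/seteqP; split; last exact: scalar_operators_tail.
move=> T tT; have [bT _] := tT 0%N I.
pose W := word_algebra P setT.
have sW : star_subalgebra W by exact: word_subalgebra.
have sub m : word_algebra P (below m) `<=` W by apply: wordS.
have dW : closure (orbit pi xi W) = setT by apply: (orbit_dense gns); exact: word_dense.
apply: (eigenvectors_scalar (orbit_subspace gns sW) dW bT) => _ [z Wz <-].
have [u0|u0] := eqVneq (dot (pi z xi) (pi z xi)) 0.
  exists 0; have -> : pi z xi = 0; last by rewrite scale0r bounded_operator0.
  by apply: hnorm_eq0; apply/eqP; rewrite -sqrf_eq0 sqr_hnorm u0.
set u := pi z xi in u0 *; exists (dot (T u) u / dot u u); apply: dot_extr => v.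
apply/eqP; rewrite -subr_eq0 -dotBl; set d := (X in dot X v).
have : closure (orbit pi xi W) v by rewrite dW.
rewrite dotC conjC_eq0; move=> clv; apply/eqP; apply: dot_closure0 clv => _ [w Ww <-].
suff : dot d (pi w xi) = 0 by rewrite dotC => /eqP; rewrite conjC_eq0 => /eqP.
set v' := pi w xi; rewrite /d dotBl dotZl; apply/eqP; rewrite subr_eq0.
rewrite mulrAC -(mulfK u0 (dot (T u) v')) -subr_eq0 -mulrBl mulf_eq0; apply/orP; left.
have [m zm] := word_below Wz; have [m' wm'] := word_below Ww.
pose n := maxn m m'.
have zn : word_algebra P (below n) z by apply: wordS zm; apply: below_subset; exact: leq_maxl.
have wn : word_algebra P (below n) w by apply: wordS wm'; apply: below_subset; exact: leq_maxr.
apply/eqP; pose g x := dot x v' * dot u u - dot x u * dot u v'.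
have -> : dot (T u) v' * dot u u - dot (T u) u * dot u v' = g (T u) by [].
apply: (@closure_bounded_eq0 _ _ [set pi y u | y in word_algebra P (above n)] g
   (hnorm v' * cmod (dot u u) + hnorm u * cmod (dot u v'))).
- by move=> x y; rewrite /g !dotBl; ring.
- move=> x; rewrite /g (le_trans (cmodD _ _)) // cmodN !cmodM mulrDl lerD //.
    by rewrite mulrAC ler_wpM2r ?cmod_ge0 // mulrC CauchySchwarz.
  by rewrite mulrAC ler_wpM2r ?cmod_ge0 // mulrC CauchySchwarz.
- move=> _ [y Wy <-]; rewrite /g /u /v' !(GNS_dot gns) !(GNS_dot2 gns).
  rewrite (wd n) // ?(wd n (star z)) //; first ring.
  + exact: word_star.
  + exact: word_star.
- exact: tail_orbit.
Qed.

End TailAlgebra.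

(** * A trivial tail algebra forces decoupling *)

Section Spreadability.
Context {R : realType} {A : cstarAlgType R} (P : freeProduct nat A).
Context (phi : P -> R[i]) (phi_spread : spreadable phi).
Local Notation tau := (fp_shiftN P).

Definition gap_shift (m n k : nat) : nat := if (k < m)%N then k else (k + n)%N.

Lemma gap_shift_increasing m n : cofinite_increasing (gap_shift m n).
Proof.
split.
  move=> j k jk; rewrite /gap_shift; case: ifPn => jm; case: ifPn => km //.
  - by rewrite (leq_trans jk) // leq_addr.
  - by rewrite -leqNgt in jm; have := leq_ltn_trans jm (ltn_trans jk km); rewrite ltnn.
  - by rewrite ltn_add2r.
apply: sub_finite_set (finite_below (m + n)) => k /= nk.
rewrite /below /= ltnNge; apply/negP => mnk; apply: nk.
have nk' : (n <= k)%N by rewrite (leq_trans _ mnk) // leq_addl.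
have mk : (m <= k - n)%N by rewrite leq_subRL // addnC.
by exists (k - n)%N; rewrite // /gap_shift ltnNge mk /= subnK.
Qed.

(** Opening a gap of length [n] at position [m] moves [y] to [tau ^ n y] and fixes
    [x] and [z]. *)
Lemma spread_word m n x y z : word_algebra P (below m) x ->
  word_algebra P (above m) y -> word_algebra P (below m) z ->
  phi (x * iter n tau y * z) = phi (x * y * z).
Proof.
move=> wx wy wz; rewrite -(phi_spread (gap_shift_increasing m n) (x * y * z)).
have h := fp_map_starhom P P (gap_shift m n).
rewrite /fp_alpha; case: (h) => _ _ -> _; case: (h) => _ _ -> _.
have fix_below w : word_algebra P (below m) w -> fp_map (P := P) P (gap_shift m n) w = w.
  apply: (starhom_word_eq h (starhom_id _)) => j a /= jm.
  by rewrite fp_map_emb /gap_shift jm.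
rewrite (fix_below _ wx) (fix_below _ wz); congr (phi (_ * _ * _)).
apply: (starhom_word_eq (shiftN_starhom P n) h) wy => j a mj.
by rewrite shiftN_emb fp_map_emb /gap_shift ltnNge mj.
Qed.

Lemma stationary n x : phi (iter n tau x) = phi x.
Proof.
elim: n => //= n <-; apply: phi_spread; split; first by move=> j k.
apply: sub_finite_set (finite_below 1) => -[|k] //= nk.
by exfalso; apply: nk; exists k.
Qed.

Context (phi_state : is_state phi).
Context {H : hilbertType R} (pi : P -> H -> H) (xi : H) (gns : is_GNS phi pi xi).

Let rpi : representation pi. Proof. by case: gns. Qed.

(** The operators [pi (tau ^ n y)] have a weak limit along a nonprincipal
    ultrafilter.  It commutes with whatever commutes with all letters of index at
    least [k], for every [k], so it is a tail operator. *)
Lemma shift_tail_operator y : word_algebra P setT y ->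
  exists2 T, tail_algebra pi T & exists2 U, UltraFilter U & \oo `<=` U /\
    forall u v, ultralimit U (fun n => dot (pi (iter n tau y) u) v) (dot (T u) v).
Proof.
move=> wy; have [U [UU oU]] := @ultraFilterLemma nat \oo _.
pose a u v n := dot (pi (iter n tau y) u) v.
have rn n : representation (fun x => pi (iter n tau x)).
  by apply: representation_comp rpi; exact: shiftN_starhom.
have bn n : bounded_operator (pi (iter n tau y)) by case: rpi => b _ _ _ _; exact: b.
have ab u v n : cmod (a u v n) <= rcnorm y * hnorm u * hnorm v.
  rewrite (le_trans (CauchySchwarz _ _)) // ler_wpM2r ?hnorm_ge0 //.
  exact: (representation_norm (rn n)).
have [B0 hB0] := choice (fun p : H * H => bounded_ultralimit UU (ab p.1 p.2)).
pose B u v := B0 (u, v); have hB u v : ultralimit U (a u v) (B u v) := hB0 (u, v).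
have riesz u : exists w, forall v, B u v = dot w v.
  have [|v|w hw] := @Riesz _ _ (fun v => (B u v)^*) (rcnorm y * hnorm u).
  - move=> c v w; rewrite -[c in RHS]conjCK -rmorphM -rmorphD; congr (_^*).
    apply: (ultralimit_uniq UU (hB _ _)).
    have := ultralimitZD UU (c^*) (hB u v) (hB u w).
    by congr ultralimit; apply/funext => n; rewrite /a dotZDr.
  - by rewrite cmod_conj; exact: (ultralimit_le UU (ab u v)).
  - by exists w => v; rewrite dotC -hw conjCK.
have [T hT] := choice riesz.
have Tl : linear T.
  move=> c u v; apply: dot_extr => w; rewrite -hT dotZDl -!hT.
  apply: (ultralimit_uniq UU (hB _ _)).
  have := ultralimitZD UU c (hB u w) (hB v w).
  by congr ultralimit; apply/funext => n; rewrite /a bounded_operatorZD // dotZDl.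
have bT : bounded_operator T.
  apply/bounded_operatorP; split=> //; exists (rcnorm y); first exact: rcnorm_ge0.
  move=> u; apply: hnorm_le_dot => [|v]; first by rewrite mulr_ge0 ?rcnorm_ge0 ?hnorm_ge0.
  by rewrite -hT; exact: (ultralimit_le UU (ab u v)).
exists T; last first.
  by exists U => //; split=> // u v; rewrite -hT; exact: hB.
move=> k _; split=> // s cs; have [bs _] := cs.
apply/funext => u; apply: dot_extr => v /=.
have [v' hv'] := adjoint_vector v bs; rewrite hv' -!hT.
apply: (ultralimit_uniq UU (hB _ _)); apply: (ultralimit_near UU _ oU (hB u v')).
exists k => // n /= kn; rewrite /a -hv' (commutant_word gns cs) //.
by apply: shiftN_word wy => j _; rewrite /above /= (leq_trans kn) // leq_addl.
Qed.

(** The limit operator is a scalar [c], and its matrix coefficients are limits of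
    constant sequences: [phi (v * y * u) = c * phi (v * u)].  The case [u = v = 1]
    gives [c = phi y]. *)
Lemma tail_decoupling : tail_algebra pi = scalar_operators -> word_decoupling phi.
Proof.
move=> tailC m x y z wx wy wz.
have [|T tT [U UU [oU hT]]] := @shift_tail_operator y; first exact: wordS wy.
have [c Tc] : scalar_operators T by rewrite -tailC.
have key u v : word_algebra P (below m) u -> word_algebra P (below m) v ->
    phi (v * y * u) = c * phi (v * u).
  move=> wu wv; have := hT (pi u xi) (pi (star v) xi).
  rewrite Tc dotZl (GNS_dot2 gns) starK => lim.
  apply: (ultralimit_uniq UU _ lim).
  have := ultralimit_cst UU (phi (v * y * u)).
  congr ultralimit; apply/funext => n.
  by rewrite (GNS_dot gns) starK (spread_word n wv wy wu).
have w1 : word_algebra P (below m) 1 by case: (word_subalgebra P (below m)).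
have := key _ _ w1 w1; rewrite !mul1r mulr1; case: (phi_state) => _ _ -> ; rewrite mulr1.
by move=> ->; rewrite key // mulrC.
Qed.

End Spreadability.

(** * Orthonormal bases and traces of positive operators *)

Section Orthonormal.
Context {R : realType} {H : hilbertType R} {I : choiceType} (e : I -> H).
Context (he : forall i j, dot (e i) (e j) = (i == j)%:R).
Implicit Types (u v w : H) (F G : {fset I}).

Lemma big_fsetsub (V : zmodType) (f : I -> V) F G : (F `<=` G)%fset ->
  \sum_(i <- G) f i = \sum_(i <- F) f i + \sum_(i <- (G `\` F)%fset) f i.
Proof.
move=> /fsubsetP FG; rewrite (big_fsetID _ (mem F)).
have -> : [fset x in G | mem F x]%fset = F.
  by apply/fsetP => i; rewrite !inE /= andbC; apply/andb_idr; exact: FG.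
suff -> : [fset x in G | ~~ mem F x]%fset = (G `\` F)%fset by [].
by apply/fsetP => i; rewrite !inE /= andbC.
Qed.

Definition fourier F u : H := \sum_(i <- F) dot u (e i) *: e i.

Lemma fourierZD F (a : R[i]) u v : fourier F (a *: u + v) = a *: fourier F u + fourier F v.
Proof.
rewrite /fourier scaler_sumr -big_split; apply: eq_bigr => i _ /=.
by rewrite dotZDl scalerDl scalerA.
Qed.

Lemma fourierB F u v : fourier F (u - v) = fourier F u - fourier F v.
Proof. by rewrite addrC -scaleN1r fourierZD scaleN1r addrC. Qed.

Lemma dot_fourierr F u v : dot (fourier F u) v = \sum_(i <- F) dot u (e i) * dot (e i) v.
Proof. by rewrite dot_suml; apply: eq_bigr => i _; rewrite dotZl. Qed.

Lemma dot_fourier_basis F u i : dot (fourier F u) (e i) = (i \in F)%:R * dot u (e i).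
Proof.
rewrite dot_fourierr; have [iF|iF] := boolP (i \in F).
  rewrite (big_fsetD1 i) //= he eqxx mulr1 mul1r big_seq big1 ?addr0 // => j.
  by rewrite !inE => /andP[ji _]; rewrite he (negPf ji) mulr0.
rewrite mul0r big_seq big1 // => j jF; rewrite he; case: eqP => [ji|]; last by rewrite mulr0.
by move: iF; rewrite -ji jF.
Qed.

Lemma sqr_hnorm_fourier F u :
  hnorm (fourier F u) ^+ 2 = \sum_(i <- F) cmod (dot u (e i)) ^+ 2.
Proof.
apply: complexI; rewrite -dot_hnorm dot_fourierr rmorph_sum /=.
rewrite big_seq [RHS]big_seq; apply: eq_bigr => i iF.
rewrite [dot (e i) _]dotC dot_fourier_basis iF mul1r -normCK normc_cmod.
by rewrite rmorphXn.
Qed.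

Lemma sqr_hnorm_fourierB F u :
  hnorm (u - fourier F u) ^+ 2 = hnorm u ^+ 2 - \sum_(i <- F) cmod (dot u (e i)) ^+ 2.
Proof.
rewrite sqr_hnormB -sqr_hnorm_fourier.
suff -> : Re (dot u (fourier F u)) = hnorm (fourier F u) ^+ 2 by ring.
rewrite sqr_hnorm; congr Re; apply/eqP; rewrite -subr_eq0 -dotBl dot_sumr.
rewrite big_seq big1 // => i iF; rewrite dotZr dotBl dot_fourier_basis iF mul1r subrr.
by rewrite mulr0.
Qed.

Lemma Bessel F u : \sum_(i <- F) cmod (dot u (e i)) ^+ 2 <= hnorm u ^+ 2.
Proof. by rewrite -subr_ge0 -sqr_hnorm_fourierB sqr_ge0. Qed.

Lemma hnorm_fourierB_le F u : hnorm (u - fourier F u) <= hnorm u.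
Proof.
rewrite -(@ler_pXn2r _ 2) ?nnegrE ?hnorm_ge0 // sqr_hnorm_fourierB lerBlDr lerDl.
by apply: sumr_ge0 => i _; rewrite sqr_ge0.
Qed.

Context (maximal : forall u, (forall i, dot u (e i) = 0) -> u = 0).

(** A maximal orthonormal family is complete: a vector orthogonal to the span is
    zero, hence the span is dense, and outside a finite set of indices the Fourier
    sums do no worse than any approximation in the span. *)
Lemma fourier_cvg u (d : R) : 0 < d ->
  exists F, forall G, (F `<=` G)%fset -> hnorm (u - fourier G u) < d.
Proof.
move=> d0; pose M : set H :=
  [set v | exists F, forall G, (F `<=` G)%fset -> fourier G v = v].
have sM : subspace M.
  split.
    exists fset0 => G _; rewrite /fourier big1 // => i _.
    by rewrite dot0l scale0r.
  move=> a v w [F hF] [F' hF']; exists (F `|` F')%fset => G.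
  by rewrite fsubUset => /andP[FG F'G]; rewrite fourierZD hF // hF'.
have eM i : M (e i).
  exists [fset i]%fset => G; rewrite fsub1set => iG; rewrite /fourier.
  rewrite (big_fsetD1 i) //= he eqxx scale1r big_seq big1 ?addr0 // => j.
  by rewrite !inE eq_sym => /andP[ij _]; rewrite he (negPf ij) scale0r.
have [p [clp orth]] := projection u sM.
have up : u = p by apply: subr0_eq; apply: maximal => i; exact: orth.
have /closureP /(_ d d0) [v [F hF] uv] : closure M u by rewrite up.
exists F => G FG; have -> : u - fourier G u = (u - v) - fourier G (u - v).
  by rewrite fourierB hF // opprB addrA subrK.
exact: le_lt_trans (hnorm_fourierB_le _ _) uv.
Qed.

End Orthonormal.

Section OrthonormalBasis.
Context {R : realType} (H : hilbertType R).

(** Needed because [has_trace] quantifies over all bases: a trace hypothesis says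
    something only if there is one. *)
Lemma orthonormal_basis_exists :
  exists (I : choiceType) (e : I -> H), orthonormal_basis e.
Proof.
pose ortho (E : set H) := forall u v, E u -> E v -> dot u v = (u == v)%:R :> R[i].
have [F Fortho Ftot|E [oE maxE]] := @Zorn_bigcup H ortho.
  move=> u v [X FX Xu] [Y FY Yv]; have [XY|YX] := Ftot X Y FX FY.
    by apply: (Fortho Y FY) => //; exact: XY.
  by apply: (Fortho X FX) => //; exact: YX.
exists (E : choiceType), (fun i : E => val i); split=> [i j|u orth].
  by rewrite oE ?val_eqE //; exact: set_valP.
apply/eqP; apply/negPn/negP => u0.
have n0 : hnorm u != 0 by apply: contra u0 => /eqP/hnorm_eq0/eqP.
pose w := ((hnorm u)^-1)%:C%C *: u.
have nw : dot w w = 1.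
  rewrite dot_hnorm hnormZ cmod_real ger0_norm ?invr_ge0 ?hnorm_ge0 //.
  by rewrite mulVf // expr1n.
have ow v : E v -> dot w v = 0.
  by move=> Ev; rewrite dotZl; have := orth (SigSub (mem_set Ev)) => /= ->; rewrite mulr0.
apply: (maxE (E `|` [set w])).
  split; first by move=> v Ev; left.
  move=> /(_ w (or_intror erefl)) Ew; have := ow w Ew; rewrite nw => /eqP.
  by rewrite oner_eq0.
have vw v : E v -> v == w = false.
  by move=> Ev; apply/eqP => vw; have := ow v Ev; rewrite vw nw => /eqP; rewrite oner_eq0.
move=> v v' [Ev|->] [Ev'|->].
- exact: oE.
- by rewrite dotC ow // rmorph0 vw.
- by rewrite ow // eq_sym vw.
- by rewrite nw eqxx.
Qed.

End OrthonormalBasis.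

Section PositiveOperators.
Context {R : realType} {H : hilbertType R}.
Implicit Types (T : H -> H) (u v w : H).

Lemma positive_operator_form T : positive_operator T ->
  [/\ forall a u v w, dot (T (a *: u + v)) w = a * dot (T u) w + dot (T v) w,
      forall a u v w, dot (T w) (a *: u + v) = a^* * dot (T w) u + dot (T w) v
    & forall u, 0 <= dot (T u) u].
Proof.
move=> [bT T0]; split=> // a u v w; first by rewrite bounded_operatorZD // dotZDl.
exact: dotZDr.
Qed.

Lemma positive_dotC T u v : positive_operator T -> dot (T v) u = (dot (T u) v)^*.
Proof.
move=> /positive_operator_form[l r p].
exact: (@form_herm _ _ (fun u v => dot (T u) v)).
Qed.

Lemma positive_CauchySchwarz T u v : positive_operator T ->
  cmod (dot (T u) v) ^+ 2 <= Re (dot (T u) u) * Re (dot (T v) v).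
Proof.
move=> /positive_operator_form[l r p].
exact: (@form_CauchySchwarz _ _ (fun u v => dot (T u) v)).
Qed.

(** Schur complements: subtracting from [T] the rank-one operator
    [<., T f> T f / <T f, f>] leaves a positive operator, which vanishes at [f] and
    wherever [T] did.  After finitely many steps [T] is a finite sum of rank-one
    positive operators up to a positive operator killing the given vectors. *)
Lemma positive_decomposition T (fs : seq H) : positive_operator T ->
  exists (ws : seq H) (T' : H -> H), [/\ positive_operator T',
    forall u, T u = \sum_(w <- ws) dot u w *: w + T' u
  & forall f, f \in fs -> T' f = 0].
Proof.
move=> pT; elim: fs => [|f fs [ws [T' [pT' TE T'0]]]].
  by exists [::], T; split=> // u; rewrite big_nil add0r.
have [bT' T'pos] := pT'.
have [a0|a0] := eqVneq (dot (T' f) f) 0.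
  exists ws, T'; split=> // g; rewrite inE => /orP[/eqP ->|]; last exact: T'0.
  apply: dot_extr => v; rewrite dot0l; apply: cmod_eq0; apply/eqP.
  rewrite -sqrf_eq0 eq_le sqr_ge0 andbT.
  by rewrite (le_trans (positive_CauchySchwarz _ _ pT')) // a0 mul0r.
have ar := ge0_ReC (T'pos f); set a := Re _ in ar.
have a1 : 0 < a.
  by rewrite lt_neqAle ge0_Re // andbT; apply: contra a0 => /eqP a0; rewrite ar -a0.
pose s := ((Num.sqrt a)^-1)%:C%C : R[i]; pose w := s *: T' f.
have ss : s * s^* = (a^-1)%:C%C.
  rewrite /s conjC_real -rmorphM /= -invfM -expr2 sqr_sqrtr //; exact: ltW.
have wE u : dot u w *: w = ((a^-1)%:C%C * dot (T' u) f) *: T' f.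
  rewrite /w dotZr scalerA -ss (positive_dotC _ _ pT') [dot u _]dotC.
  by congr (_ *: _); ring.
exists (w :: ws), (fun u => T' u - ((a^-1)%:C%C * dot (T' u) f) *: T' f); split.
- split.
    apply/bounded_operatorP; have [T'l [c c0 T'c]] := (bounded_operatorP _).1 bT'.
    split; first by move=> b u v; rewrite T'l dotZDl mulrDr scalerDl scalerBr !scalerA
      opprD addrACA mulrCA.
    exists (c + a^-1 * (c * hnorm f) * hnorm (T' f)).
      by rewrite addr_ge0 // !mulr_ge0 ?hnorm_ge0 // invr_ge0 ltW.
    move=> u; rewrite (le_trans (hnormD _ _)) // hnormN mulrDl lerD //.
    rewrite hnormZ mulrAC ler_wpM2r ?hnorm_ge0 // cmodM cmod_real ger0_norm ?invr_ge0 ?(ltW a1) //.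
    rewrite -!mulrA ler_wpM2l ?invr_ge0 ?(ltW a1) // (le_trans (CauchySchwarz _ _)) //.
    by rewrite [hnorm f * _]mulrC mulrA ler_wpM2r ?hnorm_ge0.
  move=> u; rewrite dotBl dotZl (positive_dotC u f pT') -mulrA -normCK normc_cmod.
  rewrite (ge0_ReC (T'pos u)) -rmorphXn -rmorphM -rmorphB /= ler0c subr_ge0.
  rewrite mulrC ler_pdivrMr //; exact: positive_CauchySchwarz.
- by move=> u; rewrite big_cons wE TE -addrA addrCA (addrC _ (_ - _)) subrK.
- move=> g; rewrite inE => /orP[/eqP ->|gfs].
    by rewrite ar -rmorphM mulVf ?lt0r_neq0 // scale1r subrr.
  by rewrite (T'0 g gfs) dot0l mulr0 scale0r subrr.
Qed.

Context {I : choiceType} (e : I -> H) (he : orthonormal_basis e).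

(** The Hilbert-Schmidt type estimate [tr (C^* T C) <= |C|^2 tr T].  By
    [positive_decomposition] only rank-one [T] matter, for which it is Bessel's
    inequality. *)
Lemma trace_conj_le T (C C' : H -> H) (c t : R) (G : {fset I}) :
  positive_operator T -> 0 <= c ->
  (forall u v, dot (C u) v = dot u (C' v)) -> (forall u, hnorm (C' u) <= c * hnorm u) ->
  (forall F : {fset I}, \sum_(i <- F) Re (dot (T (e i)) (e i)) <= t) ->
  \sum_(i <- G) Re (dot (T (C (e i))) (C (e i))) <= c ^+ 2 * t.
Proof.
move=> pT c0 adj C'c Tt; have [on maxl] := he.
have [ws [T' [[bT' T'0] TE T'C]]] := positive_decomposition [seq C (e i) | i <- G] pT.
have TdotE u : Re (dot (T u) u) =
    \sum_(w <- ws) cmod (dot u w) ^+ 2 + Re (dot (T' u) u).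
  rewrite TE dotDl raddfD /=; congr (_ + _).
  rewrite dot_suml raddf_sum; apply: eq_bigr => w _.
  by rewrite dotZl [dot w u]dotC -normCK normc_cmod -rmorphXn.
have step1 : \sum_(i <- G) Re (dot (T (C (e i))) (C (e i))) <=
    c ^+ 2 * \sum_(w <- ws) hnorm w ^+ 2.
  under eq_big_seq => i iG.
    rewrite TdotE T'C ?dot0l ?addr0; last by apply/mapP; exists i.
    under eq_bigr do rewrite adj.
  over.
  rewrite exchange_big mulr_sumr; apply: ler_sum => w _ /=.
  under eq_bigr do rewrite dotC cmod_conj.
  rewrite (le_trans (Bessel on _ _)) // -exprMn.
  by rewrite ler_pXn2r // ?nnegrE ?mulr_ge0 ?hnorm_ge0.
apply: (le_trans step1); rewrite ler_wpM2l ?sqr_ge0 //.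
apply/ler_addgt0Pr => d d0.
have [F hF] : exists F : {fset I}, forall F', (F `<=` F')%fset ->
    \sum_(w <- ws) hnorm w ^+ 2 <=
    \sum_(w <- ws) \sum_(i <- F') cmod (dot w (e i)) ^+ 2 + d.
  elim: (ws) d d0 => [|w s IHs] d d0.
    by exists fset0 => F' _; rewrite !big_nil add0r ltW.
  have d2 : 0 < d / 2 by rewrite divr_gt0.
  have [F hF] := IHs _ d2.
  have sd : 0 < Num.sqrt (d / 2) by rewrite sqrtr_gt0.
  have [F2 hF2] := fourier_cvg on maxl w sd.
  exists (F `|` F2)%fset => F'; rewrite fsubUset => /andP[FF' F2F'].
  rewrite !big_cons [d]splitr addrACA lerD ?hF //.
  rewrite -lerBlDl -sqr_hnorm_fourierB //.
  rewrite -(sqr_sqrtr (ltW d2)) ler_pXn2r ?nnegrE ?hnorm_ge0 ?sqrtr_ge0 //.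
  by rewrite ltW // hF2.
rewrite (le_trans (hF F (fsubset_refl F))) // lerD2r (le_trans _ (Tt F)) //.
rewrite exchange_big; apply: ler_sum => i _; rewrite TdotE.
under eq_bigr do rewrite dotC cmod_conj.
by rewrite lerDl ge0_Re.
Qed.

End PositiveOperators.

(** * Attractiveness is mixing of matrix coefficients *)

Section NullSequences.
Context {R : realType}.
Implicit Types (f g : nat -> R[i]) (l : R[i]).

Definition nullseq f : Prop :=
  forall e : R, 0 < e -> exists N, forall n, (N <= n)%N -> cmod (f n) < e.

Lemma cvg_nullseq f l :
  (fun n => f n : R[i]^o) @ \oo --> (l : R[i]^o) <-> nullseq (fun n => f n - l).
Proof.
split=> [/cvgrPdist_lt h e e0|h].
  have eC : 0 < e%:C%C :> R[i] by rewrite ltcR.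
  have [N _ hN] := h _ eC; exists N => n Nn; have := hN n Nn.
  by rewrite /= distrC normc_cmod ltcR.
apply/cvgrPdist_lt => _ /ltr_posC[e e0 ->]; have [N hN] := h e e0.
by exists N => // n /= Nn; rewrite distrC normc_cmod ltcR hN.
Qed.

Lemma nullseq_near0 f N : (forall n, (N <= n)%N -> f n = 0) -> nullseq f.
Proof. by move=> fN e e0; exists N => n Nn; rewrite fN // cmod0. Qed.

Lemma nullseq_approx f : (forall e : R, 0 < e ->
  exists2 g, nullseq g & forall n, cmod (f n - g n) <= e) -> nullseq f.
Proof.
move=> h e e0; have e2 : 0 < e / 2 by rewrite divr_gt0.
have [g g0 fg] := h _ e2; have [N hN] := g0 _ e2; exists N => n Nn.
rewrite -[f n](subrK (g n)) (le_lt_trans (cmodD _ _)) // [e]splitr.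
by rewrite ler_ltD // hN.
Qed.

Lemma nullseqD f g : nullseq f -> nullseq g -> nullseq (fun n => f n + g n).
Proof.
move=> f0 g0 e e0; have e2 : 0 < e / 2 by rewrite divr_gt0.
have [N hN] := f0 _ e2; have [N' hN'] := g0 _ e2; exists (maxn N N') => n.
rewrite geq_max => /andP[Nn Nn'].
by rewrite (le_lt_trans (cmodD _ _)) // [e]splitr ltrD ?hN ?hN'.
Qed.

Lemma nullseqZ l f : nullseq f -> nullseq (fun n => l * f n).
Proof.
move=> f0 e e0; have l1 : 0 < cmod l + 1 by rewrite ltr_wpDl ?cmod_ge0.
have [N hN] := f0 _ (divr_gt0 e0 l1); exists N => n Nn; rewrite cmodM.
apply: le_lt_trans (_ : (cmod l + 1) * cmod (f n) < _).
  by rewrite ler_wpM2r ?cmod_ge0 // lerDl.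
by rewrite mulrC -ltr_pdivlMr // hN.
Qed.

Lemma nullseq_sum (J : Type) (s : seq J) (f : J -> nat -> R[i]) :
  (forall j, nullseq (f j)) -> nullseq (fun n => \sum_(j <- s) f j n).
Proof.
move=> f0; elim: s => [|j s IHs].
  by apply: (@nullseq_near0 _ 0) => n _; rewrite big_nil.
rewrite (_ : (fun n => _) = (fun n => f j n + \sum_(j <- s) f j n)).
  exact: nullseqD.
by apply/funext => n; rewrite big_cons.
Qed.

Lemma nullseq_cst l : nullseq (fun=> l) -> l = 0.
Proof.
move=> h; apply: (@cmod_small_eq0 _ _ 1) => e e0; have [N hN] := h e e0.
by rewrite mul1r ltW // (hN N).
Qed.

Lemma has_sumP (I : choiceType) (f : I -> R[i]) l :
  partial_sum (fun i => f i : R[i]^o) @ totally --> (l : R[i]^o) <->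
  forall e : R, 0 < e -> exists F : {fset I}, forall G : {fset I}, (F `<=` G)%fset ->
    cmod (\sum_(i <- G) f i - l) < e.
Proof.
have FT : Filter (@totally I) := @filter_filter _ _ totally_filter.
split=> [/cvgrPdist_lt h e e0|h].
  have eC : 0 < e%:C%C :> R[i] by rewrite ltcR.
  have [F _ hF] := h _ eC; exists F => G FG; have := hF G FG.
  by rewrite /= distrC normc_cmod ltcR /partial_sum big_seq_fsetE.
apply/cvgrPdist_lt => _ /ltr_posC[e e0 ->]; have [F hF] := h e e0.
exists F => // G /= FG; rewrite distrC normc_cmod ltcR /partial_sum.
by have := hF G FG; rewrite big_seq_fsetE.
Qed.

End NullSequences.

Lemma nullseq_dense (R : realType) (H : hilbertType R) (M : set H)
    (f : H -> nat -> R[i]) (c : R) u : closure M = setT ->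
  0 <= c -> (forall u v n, cmod (f u n - f v n) <= c * hnorm (u - v)) ->
  (forall v, M v -> nullseq (f v)) -> nullseq (f u).
Proof.
move=> dM c0 fc fM; apply: nullseq_approx => e e0.
have c1 : 0 < c + 1 by rewrite ltr_wpDl.
have /closureP /(_ _ (divr_gt0 e0 c1)) [v Mv uv] : closure M u by rewrite dM.
exists (f v); first exact: fM.
move=> n; rewrite (le_trans (fc _ _ _)) //.
apply: le_trans (_ : (c + 1) * hnorm (u - v) <= _).
  by rewrite ler_wpM2r ?hnorm_ge0 // lerDl.
by rewrite mulrC -ler_pdivlMr // ltW.
Qed.

Section NormalStates.
Context {R : realType} {A : cstarAlgType R} (P : freeProduct nat A).
Context {H : hilbertType R} (pi : P -> H -> H) (rpi : representation pi).
Context (phi : P -> R[i]).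
Local Notation tau := (fp_shiftN P).

(** Parseval's identity, as the trace of a rank-one operator. *)
Lemma has_trace_rank1 (u v : H) : has_trace (fun w => dot w u *: v) (dot v u).
Proof.
move=> I e [on maxl]; apply/has_sumP => d d0.
have u1 : 0 < hnorm u + 1 by rewrite ltr_wpDl ?hnorm_ge0.
have [F hF] := fourier_cvg on maxl v (divr_gt0 d0 u1); exists F => G FG.
have -> : \sum_(i <- G) dot (dot (e i) u *: v) (e i) = dot (fourier e G v) u.
  by rewrite dot_fourierr; apply: eq_bigr => i _; rewrite dotZl mulrC.
rewrite -dotBl (le_lt_trans (CauchySchwarz _ _)) // hnormB.
apply: le_lt_trans (_ : hnorm (v - fourier e G v) * (hnorm u + 1) < _).
  by rewrite ler_wpM2l ?hnorm_ge0 // lerDl.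
by rewrite -ltr_pdivlMr // hF.
Qed.

Lemma vector_state_normal (u : H) : dot u u = 1 ->
  normal_states pi (fun x => dot (pi x u) u).
Proof.
move=> u1; exists (fun w => dot w u *: u); split.
- split.
    apply/bounded_operatorP; split.
      by move=> a v w; rewrite dotZDl scalerDl scalerA.
    exists (hnorm u * hnorm u); first by rewrite mulr_ge0 ?hnorm_ge0.
    move=> w; rewrite hnormZ mulrAC ler_wpM2r ?hnorm_ge0 // mulrC.
    exact: CauchySchwarz.
  by move=> w; rewrite dotZl [dot u w]dotC -normCK exprn_ge0.
- by have := @has_trace_rank1 u u; rewrite u1.
- move=> x; have := @has_trace_rank1 u (pi x u); congr has_trace.
  by apply/funext => w /=; case: rpi => b _ _ _ _; rewrite bounded_operatorZ.
Qed.

(** Vector functionals are weak counterparts of normal states, easier to handle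
    because density arguments apply to each vector separately. *)
Definition mixing : Prop := forall x u v,
  nullseq (fun n => dot (pi (iter n tau x) u) v - phi x * dot u v).

(** Vector states give the diagonal coefficients; polarization gives the others. *)
Lemma attractive_mixing : attractive pi phi -> mixing.
Proof.
move=> att x.
have piZD y (a : R[i]) u v : pi y (a *: u + v) = a *: pi y u + pi y v.
  by case: rpi => b _ _ _ _; rewrite bounded_operatorZD.
have piZ y (a : R[i]) u : pi y (a *: u) = a *: pi y u.
  by case: rpi => b _ _ _ _; rewrite bounded_operatorZ.
pose g u v n := dot (pi (iter n tau x) u) v - phi x * dot u v.
have gZD (a b : R[i]) u v u' v' n : g (a *: u + v) (b *: u' + v') n =
    a * b^* * g u u' n + a * g u v' n + b^* * g v u' n + g v v' n.
  by rewrite /g piZD !dotZDl !dotZDr; ring.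
have diag u : nullseq (g u u).
  have [u0|u0] := eqVneq u 0.
    apply: (@nullseq_near0 _ _ 0) => n _.
    by rewrite /g u0 !dot0r mulr0 subrr.
  have n0 : hnorm u != 0 by apply: contra u0 => /eqP/hnorm_eq0/eqP.
  pose w := ((hnorm u)^-1)%:C%C *: u.
  have nw : dot w w = 1.
    rewrite dot_hnorm hnormZ cmod_real ger0_norm ?invr_ge0 ?hnorm_ge0 //.
    by rewrite mulVf // expr1n.
  have := att _ (vector_state_normal nw) x => /cvg_nullseq /(nullseqZ ((hnorm u) ^+ 2)%:C%C).
  congr nullseq; apply/funext => n /=.
  have h2 : (hnorm u ^+ 2)%:C%C * ((hnorm u)^-1)%:C%C * ((hnorm u)^-1)%:C%C = 1 :> R[i].
    by rewrite -!rmorphM /= expr2 mulfK // mulfV.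
  have sc (z : R[i]) :
      (hnorm u ^+ 2)%:C%C * (((hnorm u)^-1)%:C%C * (((hnorm u)^-1)%:C%C * z)) = z.
    by rewrite !mulrA h2 mul1r.
  rewrite mulrBr /g /w piZ dotZl dotZr conjC_real sc dot_hnorm; congr (_ - _).
  by rewrite mulrC.
have sym u v : nullseq (fun n => g u v n + g v u n).
  have := nullseqD (diag (1 *: u + v))
    (nullseqD (nullseqZ (-1) (diag u)) (nullseqZ (-1) (diag v))).
  by congr nullseq; apply/funext => n; rewrite gZD rmorph1; ring.
move=> u v; rewrite -/(g u v).
have h := nullseqZ (2^-1) (nullseqD (sym u v) (nullseqZ (- 'i%C) (sym ('i%C *: u) v))).
have i2 : - 'i%C * 'i%C = 1 :> R[i] by rewrite mulNr -expr2 sqr_i opprK.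
have ci : ('i%C : R[i])^* = - 'i%C by apply/eqP; rewrite eq_complex /= oppr0 !eqxx.
move: h; congr nullseq; apply/funext => n.
have -> : g ('i%C *: u) v n = 'i%C * g u v n by rewrite /g piZ !dotZl; ring.
have -> : g v ('i%C *: u) n = - 'i%C * g v u n by rewrite /g !dotZr ci; ring.
have -> : - 'i%C * ('i%C * g u v n + - 'i%C * g v u n) = g u v n - g v u n.
  by rewrite mulrDr !mulrA i2 mul1r mulrNN -expr2 sqr_i mulN1r.
by move: (g u v n) (g v u n) => p q; field.
Qed.

(** The tails of the sums computing a normal state [tr (pi y T)] are small uniformly
    over the elements [y = tau ^ n x], by the weighted Cauchy-Schwarz inequality for
    the form [<T u, v>] and the trace bound [trace_conj_le]. *)
Lemma mixing_attractive : mixing -> attractive pi phi.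
Proof.
move=> mix w [T [pT trT trw]] x; apply/cvg_nullseq.
have [I [e onb]] := orthonormal_basis_exists H.
have [bT T0] := pT; have [Tl Tr Tp] := positive_operator_form pT.
pose t i := Re (dot (T (e i)) (e i)).
have tE (F : {fset I}) : \sum_(i <- F) dot (T (e i)) (e i) = (\sum_(i <- F) t i)%:C%C.
  by rewrite rmorph_sum; apply: eq_bigr => i _; rewrite /t /= -ge0_ReC.
have t0 i : 0 <= t i by exact: ge0_Re.
have /has_sumP trT1 := trT I e onb.
have tD (F G : {fset I}) : (F `<=` G)%fset ->
    \sum_(i <- G) t i = \sum_(i <- F) t i + \sum_(i <- (G `\` F)%fset) t i.
  exact: big_fsetsub.
have t1 (F : {fset I}) : \sum_(i <- F) t i <= 1.
  apply/ler_addgt0Pr => d d0; have [F' hF'] := trT1 d d0.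
  have := hF' (F `|` F')%fset (fsubsetUr _ _); rewrite tE -[1 in X in X -> _]/(1%:C%C).
  rewrite -rmorphB /= cmod_real => /(le_lt_trans (ler_norm _)).
  rewrite ltrBlDl (tD F) ?fsubsetUl // => /ltW; apply: le_trans.
  by rewrite lerDl sumr_ge0.
have c0 := rcnorm_ge0 x; set c := rcnorm x in c0.
have rn n : representation (fun x => pi (iter n tau x)).
  by apply: representation_comp rpi; exact: shiftN_starhom.
have key n (G : {fset I}) : \sum_(i <- G) Re (dot (T (pi (star (iter n tau x)) (e i)))
    (pi (star (iter n tau x)) (e i))) <= c ^+ 2.
  rewrite -[leRHS]mulr1; apply: (trace_conj_le onb (C' := pi (iter n tau x))) => //.
    by move=> u v; case: rpi.
  by move=> u; exact: (representation_norm (rn n)).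
apply: nullseq_approx => d0 d00.
(* The error is at most [2 * d + cmod (phi x) * d]: [d] for the approximation of the
   trace by a partial sum, [d] for the tail, [cmod (phi x) * d] for the missing mass
   [1 - \sum_(i <- F) t i <= r].  The weight [s] makes both terms of the weighted
   Cauchy-Schwarz bound on twice the tail at most [d]. *)
pose d := d0 / (2 + cmod (phi x)).
have p2 : 0 < 2 + cmod (phi x) by rewrite ltr_pwDl ?cmod_ge0.
have dp : 0 < d by rewrite divr_gt0.
pose s := (c ^+ 2 + 1) / d.
have sp : 0 < s by rewrite divr_gt0 // ltr_wpDl ?sqr_ge0.
pose r := Num.min (d / s) d.
have rp : 0 < r by rewrite lt_min dp divr_gt0.
have [F hF] := trT1 r rp.
have Ftail (G : {fset I}) : (F `<=` G)%fset -> \sum_(i <- (G `\` F)%fset) t i <= r.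
  move=> FG; have := hF F (fsubset_refl F); rewrite tE -[1 in X in X -> _]/(1%:C%C).
  rewrite -rmorphB /= cmod_real distrC => /(le_lt_trans (ler_norm _)) /ltW.
  by have := t1 G; rewrite (tD _ _ FG); lra.
exists (fun n => \sum_(i <- F) (dot (pi (iter n tau x) (T (e i))) (e i)
    - phi x * dot (T (e i)) (e i))).
  by apply: nullseq_sum => i; exact: mix.
move=> n; rewrite sumrB -mulr_sumr.
set y := iter n tau x; set f := fun i => dot (pi y (T (e i))) (e i).
have /has_sumP/(_ d dp)[F2 hF2] := trw y I e onb.
pose G := (F `|` F2)%fset; have FG : (F `<=` G)%fset by exact: fsubsetUl.
have Gw := hF2 G (fsubsetUr _ _); rewrite -/f in Gw.
have split_f := big_fsetsub f FG.
have tailb : cmod (\sum_(i <- (G `\` F)%fset) f i) <= d.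
  apply: (le_trans (cmod_sum _ _ _)).
  suff : 2 * \sum_(i <- (G `\` F)%fset) cmod (f i) <= 2 * d by rewrite ler_pM2l.
  rewrite mulr_sumr.
  apply: le_trans (_ : \sum_(i <- (G `\` F)%fset) (s * t i + s^-1 *
     Re (dot (T (pi (star y) (e i))) (pi (star y) (e i)))) <= _).
    apply: ler_sum => i _.
    have -> : f i = dot (T (e i)) (pi (star y) (e i)).
      by rewrite /f -[in LHS](starK y); case: rpi => _ _ _ _ ->.
    exact: (@form_CauchySchwarz_weighted _ _ (fun u v => dot (T u) v)).
  rewrite big_split -!mulr_sumr mulr2n mulrDl mul1r; apply: lerD.
    rewrite mulrC -ler_pdivlMr // (le_trans (Ftail G FG)) //.
    by rewrite /r ge_min lexx.
  rewrite mulrC ler_pdivrMr // (le_trans (key n _)) // /s mulrCA mulfV ?lt0r_neq0 //.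
  by rewrite mulr1 lerDl.
have -> : w y - phi x - (\sum_(i <- F) f i - phi x * \sum_(i <- F) dot (T (e i)) (e i)) =
    - (\sum_(i <- G) f i - w y) + \sum_(i <- (G `\` F)%fset) f i
    + phi x * (\sum_(i <- F) dot (T (e i)) (e i) - 1).
  by rewrite split_f; ring.
have -> : d0 = d + d + cmod (phi x) * d.
  by rewrite /d; field; rewrite lt0r_neq0.
rewrite (le_trans (cmodD _ _)) //.
have b3 : cmod (phi x * (\sum_(i <- F) dot (T (e i)) (e i) - 1)) <= cmod (phi x) * d.
  rewrite cmodM ler_wpM2l ?cmod_ge0 // ltW // (lt_le_trans (hF F (fsubset_refl F))) //.
  by rewrite /r ge_min lexx orbT.
have b12 := cmodD (- (\sum_(i <- G) f i - w y)) (\sum_(i <- (G `\` F)%fset) f i).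
rewrite cmodN in b12; move: Gw tailb b3 b12 (ltW dp).
move: (cmod (_ - w y)) (cmod (\sum_(i <- _) f i)) (cmod (phi x * _)) (cmod (_ + _)).
move=> x1 x2 x3 x4; move: (cmod _ * d) => x5; lra.
Qed.

End NormalStates.

(** * Mixing of the bilateral representation is equivalent to decoupling *)

Section BilateralExtension.
Context {R : realType} {A : cstarAlgType R} (P : freeProduct nat A) (Q : freeProduct int A).
Context (phi : P -> R[i]) (phi_state : is_state phi) (phi_spread : spreadable phi).
Context {H : hilbertType R} (pi : P -> H -> H) (xi : H) (gns : is_GNS phi pi xi).
Context (phiZ : Q -> R[i]) (phiZ_ext : bilateral_extension phi phiZ).
Context {HZ : hilbertType R} (piZ : Q -> HZ -> HZ) (xiZ : HZ) (gnsZ : is_GNS phiZ piZ xiZ).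
Local Notation tau := (fp_shiftN P).
Local Notation tauZ := (fp_shiftZ Q).
Local Notation incl := (fp_inclusion P Q).
Local Notation piN := (fun x => piZ (incl x)).

Lemma inclusion_starhom : unital_starhom incl.
Proof. exact: fp_map_starhom. Qed.

Lemma inclusion_representation : representation piN.
Proof. by apply: representation_comp inclusion_starhom _; case: gnsZ. Qed.

Lemma shiftZ_inclusion m y : word_algebra P setT y ->
  iter m tauZ (incl y) = incl (iter m tau y).
Proof.
apply: (starhom_word_eq (starhom_comp inclusion_starhom (shiftZ_starhom Q m))
  (starhom_comp (shiftN_starhom P m) inclusion_starhom)) => j a _ /=.
by rewrite /fp_inclusion fp_map_emb shiftZ_emb shiftN_emb fp_map_emb PoszD.
Qed.

Lemma phiZ_shift m q : phiZ (iter m tauZ q) = phiZ q.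
Proof. by case: phiZ_ext => _ inv _; elim: m => //= m <-. Qed.

(** The letters of [q] are finitely many, so their indices are bounded below. *)
Lemma shiftZ_word q : word_algebra Q setT q ->
  exists m0, forall m, (m0 <= m)%N ->
    exists2 p, word_algebra P setT p & iter m tauZ q = incl p.
Proof.
move=> wq; have [||m0 wm0] := word_exhaust (I := fun n => [set j : int | - n%:Z <= j]) _ _ wq.
- by move=> m n mn j /=; apply: le_trans; rewrite lerN2 lez_nat.
- by move=> j _; exists `|j|%N; rewrite /= abszE lerNl -normrN ler_norm.
exists m0 => m m0m; suff : (iter m tauZ @^-1` (incl @` word_algebra P setT)) q.
  by move=> [p wp ep]; exists p.
move: q wm0 {wq}; apply: word_ind.
  apply: starhom_preim; first exact: shiftZ_starhom.
  by apply: starhom_image_subalgebra; [exact: inclusion_starhom|exact: word_subalgebra].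
move=> j a /= jm0; exists (fp_emb P `|(j + m%:Z)%R|%N a); first exact: word_emb.
rewrite shiftZ_emb /fp_inclusion fp_map_emb; congr (fp_emb Q _ a).
by rewrite abszE ger0_norm // -lerBlDr sub0r (le_trans _ jm0) // lerN2 lez_nat.
Qed.

(** Spreadability makes the relevant matrix coefficients constant sequences. *)
Lemma mixing_decoupling : mixing piN phi -> word_decoupling phi.
Proof.
move=> mix m x y z wx wy wz.
have := mix y (piZ (incl z) xiZ) (piZ (star (incl x)) xiZ).
have [_ _ iM _] := inclusion_starhom; have [_ _ ext] := phiZ_ext.
rewrite (GNS_dot2 gnsZ) starK -iM ext => lim.
apply: subr0_eq; apply: nullseq_cst; move: lim; congr nullseq; apply/funext => n.
by rewrite (GNS_dot gnsZ) starK -!iM ext (spread_word phi_spread n wx wy wz) mulrC.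
Qed.

Let b x u v n : R[i] := dot (piN (iter n tau x) u) v - phi x * dot u v.

(** A power of the bilateral shift moves [z] and [w] into the one-sided algebra
    without changing the matrix coefficient, which decoupling then computes. *)
Lemma mixing_orbit x z w : word_decoupling phi -> word_algebra P setT x ->
  word_algebra Q setT z -> word_algebra Q setT w ->
  nullseq (b x (piZ z xiZ) (piZ w xiZ)).
Proof.
move=> wd wx wz ww.
have [m1 h1] := shiftZ_word wz; have [m2 h2] := shiftZ_word ww.
pose m := maxn m1 m2.
have [pz wpz ez] := h1 m (leq_maxl _ _); have [pw wpw ew] := h2 m (leq_maxr _ _).
have [k1 bz] := word_below wpz; have [k2 bw] := word_below (word_star wpw).
pose k := maxn k1 k2.
have {}bz : word_algebra P (below k) pz by apply: wordS bz; apply: below_subset; exact: leq_maxl.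
have {}bw : word_algebra P (below k) (star pw).
  by apply: wordS bw; apply: below_subset; exact: leq_maxr.
apply: (@nullseq_near0 _ _ k) => n kn; apply/eqP; rewrite subr_eq0; apply/eqP.
rewrite (GNS_dot gnsZ) (GNS_dot2 gnsZ) -(phiZ_shift m) -[in RHS](phiZ_shift m).
have [_ _ sM ss] := shiftZ_starhom Q m; have [_ _ iM is_] := inclusion_starhom.
have wx' : word_algebra P setT (iter n tau x) by apply: shiftN_word wx.
rewrite !sM !ss ez ew shiftZ_inclusion // -!is_ -!iM.
have [_ _ ext] := phiZ_ext; rewrite !ext -iterD (wd k) //; last first.
  apply: shiftN_word wx => j _; rewrite /above /=.
  by rewrite (leq_trans kn) // addnA leq_addl.
by rewrite (stationary phi_spread) mulrC.
Qed.

Lemma mixing_bound x u v n : cmod (b x u v n) <= 2 * (rcnorm x * hnorm u * hnorm v).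
Proof.
have rn : representation (fun x => piN (iter n tau x)).
  exact: (representation_comp (pi := piN) (shiftN_starhom P n) inclusion_representation).
rewrite (le_trans (cmodD _ _)) // cmodN mulr2n mulrDl mul1r; apply: lerD.
  rewrite (le_trans (CauchySchwarz _ _)) // ler_wpM2r ?hnorm_ge0 //.
  exact: (representation_norm rn).
rewrite cmodM -mulrA; apply: ler_pM; rewrite ?cmod_ge0 //; last exact: CauchySchwarz.
by apply: (GNS_bounded gns); case: phi_state.
Qed.

(** Decoupling computes the matrix coefficients in the vectors of the dense orbit;
    contractivity of the representations [piN \o tau ^ n], uniform in [n], extends
    the convergence to all vectors and all elements. *)
Lemma decoupling_mixing : word_decoupling phi -> mixing piN phi.
Proof.
move=> wd.
have dO : closure (orbit piZ xiZ (word_algebra Q setT)) = setT.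
  by apply: (orbit_dense gnsZ); exact: word_dense.
have piB y u v : piN y (u - v) = piN y u - piN y v.
  by rewrite bounded_operatorB //; case: inclusion_representation.
have step1 x z v : word_algebra P setT x -> word_algebra Q setT z ->
    nullseq (b x (piZ z xiZ) v).
  move=> wx wz; apply: (@nullseq_dense _ _ _ (b x (piZ z xiZ))
    (2 * (rcnorm x * hnorm (piZ z xiZ))) v dO).
  - by rewrite !mulr_ge0 ?rcnorm_ge0 ?hnorm_ge0.
  - move=> v1 v2 n; have -> : b x (piZ z xiZ) v1 n - b x (piZ z xiZ) v2 n =
      b x (piZ z xiZ) (v1 - v2) n by rewrite /b !dotBr; ring.
    by rewrite -mulrA mixing_bound.
  - by move=> _ [w ww <-]; exact: mixing_orbit.
have step2 x u v : word_algebra P setT x -> nullseq (b x u v).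
  move=> wx; apply: (@nullseq_dense _ _ _ (fun u => b x u v) (2 * (rcnorm x * hnorm v)) u dO).
  - by rewrite !mulr_ge0 ?rcnorm_ge0 ?hnorm_ge0.
  - move=> u1 u2 n; have -> : b x u1 v n - b x u2 v n = b x (u1 - u2) v n.
      by rewrite /b piB !dotBl; ring.
    by rewrite (le_trans (mixing_bound _ _ _ _)) // -!mulrA [hnorm v * _]mulrC.
  - by move=> _ [z wz <-]; exact: step1.
move=> x u v; apply: nullseq_approx => e e0.
pose c := 2 * (hnorm u * hnorm v).
have c0 : 0 <= c by rewrite !mulr_ge0 ?hnorm_ge0.
have c1 : 0 < c + 1 by rewrite ltr_wpDl.
have : closure (word_algebra P setT) x by rewrite word_dense.
move=> /cstar_closureP /(_ _ (divr_gt0 e0 c1)) [y wy xy].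
exists (b y u v); first exact: step2.
move=> n; have -> : dot (piN (iter n tau x) u) v - phi x * dot u v - b y u v n = b (x - y) u v n.
  have rn : representation (fun x => piN (iter n tau x)).
    exact: (representation_comp (pi := piN) (shiftN_starhom P n) inclusion_representation).
  have phiB : phi (x - y) = phi x - phi y.
    by case: phi_state => phil _ _; rewrite addrC -scaleN1r phil mulN1r addrC.
  by rewrite /b phiB (representationB rn) !dotBl; ring.
rewrite (le_trans (mixing_bound _ _ _ _)) //.
apply: le_trans (_ : (c + 1) * rcnorm (x - y) <= _).
  have -> : 2 * (rcnorm (x - y) * hnorm u * hnorm v) = c * rcnorm (x - y) by rewrite /c; ring.
  by rewrite ler_wpM2r ?rcnorm_ge0 // lerDl.
by rewrite mulrC -ler_pdivlMr // ltW.
Qed.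

End BilateralExtension.

(** * Exchangeable states *)

Section FinitePermutations.

Definition transposition (a b k : nat) : nat :=
  if k == a then b else if k == b then a else k.

Lemma transpositionK a b : involutive (transposition a b).
Proof.
move=> k; rewrite /transposition; have [->|ka] := eqVneq k a.
  by have [->|ba] := eqVneq b a; rewrite ?eqxx.
have [->|kb] := eqVneq k b; first by rewrite eqxx.
by rewrite (negPf ka) (negPf kb).
Qed.

(** Built one value after another: a transposition corrects the image of [N] and, by
    injectivity, leaves the earlier values alone. *)
Lemma finite_perm_extension (h : nat -> nat) (N : nat) : {in gtn N &, injective h} ->
  exists2 s, finite_perm s & forall k, (k < N)%N -> s k = h k.
Proof.
elim: N => [|N IHN] hinj.
  exists id => //; split; first by exists id.
  by rewrite (_ : [set n : nat | id n <> n] = set0) // -subset0 => n /=; apply.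
have [|s [bs fs] sh] := IHN.
  by move=> j k jN kN; apply: hinj; rewrite inE ltnW.
exists (transposition (s N) (h N) \o s).
  split; first exact: (bij_comp (inv_bij (transpositionK _ _)) bs).
  apply: (@sub_finite_set _ _ ([set n | s n <> n] `|` [set s N; h N])).
    move=> n /= nn; have [sn|sn] := pselect (s n = n); last by left.
    right; move: nn; rewrite sn /transposition.
    by case: eqP => [->|_]; [left|case: eqP => [->|//]; right].
  by rewrite !finite_setU; split=> //; split; exact: finite_set1.
move=> k; rewrite ltnS leq_eqVlt => /orP[/eqP ->|kN] /=.
  by rewrite /transposition eqxx.
rewrite /transposition; case: eqP => [skN|_].
  by have := bij_inj bs skN => kN'; move: kN; rewrite kN' ltnn.
case: eqP => [skN|_]; last exact: sh.
have : h k = h N by rewrite -sh.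
by move=> /hinj; rewrite !inE => /(_ (ltnW kN) (ltnSn N)) kN'; move: kN; rewrite kN' ltnn.
Qed.

End FinitePermutations.

Section Exchangeability.
Context {R : realType} {A : cstarAlgType R} (P : freeProduct nat A).
Context (phi : P -> R[i]) (phi_state : is_state phi) (phi_exch : exchangeable phi).
Context {H : hilbertType R} (pi : P -> H -> H) (xi : H) (gns : is_GNS phi pi xi).

Let phil : scalar phi. Proof. by case: phi_state. Qed.

Lemma exchangeable_word (h : nat -> nat) (N : nat) (x : P) : {in gtn N &, injective h} ->
  word_algebra P (below N) x -> phi (fp_alpha h x) = phi x.
Proof.
move=> hinj wx; have [s ps sh] := finite_perm_extension hinj.
rewrite -(phi_exch ps x); congr phi.
apply: (starhom_word_eq (fp_map_starhom P P h) (fp_map_starhom P P s)) wx => j a jN.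
by rewrite !fp_map_emb sh.
Qed.

(** On an element with finitely many letters an increasing map agrees with a finite
    permutation; the others are reached through the contractive representation
    [pi \o fp_alpha h]. *)
Lemma exchangeable_spreadable : spreadable phi.
Proof.
move=> h [hincr _] x; apply: subr0_eq.
have rpi : representation pi by case: gns.
have ah := fp_map_starhom P P h.
have phiB y z : phi (y - z) = phi y - phi z.
  by rewrite addrC -scaleN1r phil mulN1r addrC.
have alphaB (y z : P) : fp_alpha h (y - z) = fp_alpha h y - fp_alpha h z.
  by case: ah => l _ _ _; rewrite /fp_alpha addrC -scaleN1r l scaleN1r addrC.
have bd (f : P -> P) y : unital_starhom f ->
    cmod (phi (f y)) <= hnorm xi ^+ 2 * rcnorm y.
  move=> fh; case: (gns) => _ _ ->; rewrite (le_trans (CauchySchwarz _ _)) //.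
  rewrite expr2 mulrAC ler_wpM2r ?hnorm_ge0 // mulrC.
  exact: (representation_norm (representation_comp fh rpi)).
apply: (@closure_functional_eq0 _ _ (word_algebra P setT)
  (fun x => phi (fp_alpha h x) - phi x) (hnorm xi ^+ 2 + hnorm xi ^+ 2)).
- by move=> y z; rewrite alphaB !phiB; ring.
- move=> y; rewrite (le_trans (cmodD _ _)) // cmodN mulrDl lerD //; first exact: bd ah.
  exact: (bd id y (starhom_id _)).
- move=> y /word_below[N wy]; rewrite (@exchangeable_word _ N) ?subrr // => j k _ _ e.
  by case: (ltngtP j k) => // /hincr; rewrite e ltnn.
- by rewrite word_dense.
Qed.

(** A finite permutation moves the block of [y] beyond the blocks of [x] and [z],
    so forward decoupling suffices for disjoint blocks. *)
Lemma block_singletonP : block_singleton phi <-> forward_decoupling phi.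
Proof.
split=> [bs Fx Fy Fz x y z fx fy fz lx ly lz far|].
  apply: (bs Fx Fy Fz) => //; rewrite -subset0 => j [Fj Gj].
  by have := far j j Fj Gj; rewrite ltnn.
move=> /(forward_decouplingP phi_state gns) wd Fx Fy Fz x y z fx fy fz lx ly lz disj.
apply: (factorization_closure phil _ _ (localized_closure lx) (localized_closure ly)
  (localized_closure lz)).
  by move=> w; apply: (GNS_bounded gns); case: phi_state.
move=> {lx ly lz} {}x {}y {}z wx wy wz.
have [N FN] : exists N, Fy `|` (Fx `|` Fz) `<=` below N.
  by apply: finite_set_below; rewrite !finite_setU.
have Fx_y j : Fx j -> ~ Fy j.
  by move=> Fxj Fyj; have : (Fy `&` (Fx `|` Fz)) j by [split=> //; left]; rewrite disj.
have Fz_y j : Fz j -> ~ Fy j.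
  by move=> Fxj Fyj; have : (Fy `&` (Fx `|` Fz)) j by [split=> //; right]; rewrite disj.
pose h j := if `[< Fy j >] then (j + N)%N else j.
have hinj : {in gtn N &, injective h}.
  move=> j k; rewrite !inE /h => jN kN; case: asboolP => _; case: asboolP => _ //.
  - by move/addIn.
  - by move=> e; move: kN; rewrite -e ltnNge leq_addl.
  - by move=> e; move: jN; rewrite e ltnNge leq_addl.
have wxN : word_algebra P (below N) x by apply: wordS wx => j Fj; apply: FN; right; left.
have wyN : word_algebra P (below N) y by apply: wordS wy => j Fj; apply: FN; left.
have wzN : word_algebra P (below N) z by apply: wordS wz => j Fj; apply: FN; right; right.
have ah := fp_map_starhom P P h; have [_ _ aM _] := ah.
rewrite -(exchangeable_word hinj (word_mul (word_mul wxN wyN) wzN)).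
have fixed F w : (forall j, F j -> ~ Fy j) -> word_algebra P F w -> fp_alpha h w = w.
  move=> FFy; apply: (starhom_word_eq ah (starhom_id _)) => j a Fj.
  by rewrite fp_map_emb /h; case: asboolP => // /(FFy j Fj).
rewrite /fp_alpha !aM -!/(fp_alpha h _) (fixed Fx x) // (fixed Fz z) //.
rewrite (wd N) // ?(exchangeable_word hinj wyN) //.
apply: (starhom_word (s := h) ah) wy => [j a _|j Fj]; first by rewrite fp_map_emb.
by rewrite /h /above /=; case: asboolP => // _; exact: leq_addl.
Qed.

End Exchangeability.

Theorem theorem5p3 (R : realType) (A : cstarAlgType R)
    (P : freeProduct nat A) (Q : freeProduct int A)
    (phi : P -> R[i]) (phi_state : is_state phi)
    (phiZ : Q -> R[i]) (phiZ_ext : bilateral_extension phi phiZ)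
    (H : hilbertType R) (pi : P -> H -> H) (xi : H)
    (phi_GNS : is_GNS phi pi xi)
    (HZ : hilbertType R) (piZ : Q -> HZ -> HZ) (xiZ : HZ)
    (phiZ_GNS : is_GNS phiZ piZ xiZ) :
  (spreadable phi ->
    [<-> tail_algebra pi = scalar_operators;
         forward_decoupling phi;
         attractive (fun x => piZ (fp_inclusion P Q x)) phi])
  /\
  (exchangeable phi ->
    [<-> tail_algebra pi = scalar_operators;
         block_singleton phi;
         attractive (fun x => piZ (fp_inclusion P Q x)) phi]).
Proof.
have main : spreadable phi ->
    [/\ tail_algebra pi = scalar_operators -> forward_decoupling phi,
        forward_decoupling phi -> attractive (fun x => piZ (fp_inclusion P Q x)) phi
      & attractive (fun x => piZ (fp_inclusion P Q x)) phi ->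
        tail_algebra pi = scalar_operators].
  move=> spread; have rN := inclusion_representation P phiZ_GNS; split.
  - move=> tailC; apply/(forward_decouplingP phi_state phi_GNS).
    exact: (tail_decoupling spread phi_state phi_GNS).
  - move=> /(forward_decouplingP phi_state phi_GNS) wd; apply: (mixing_attractive rN).
    exact: (decoupling_mixing phi_state spread phi_GNS phiZ_ext phiZ_GNS wd).
  - move=> att; apply: (decoupling_tail phi_GNS).
    apply: (mixing_decoupling spread phiZ_ext phiZ_GNS).
    exact: (attractive_mixing rN att).
split=> [spread|exch].
  by have [h1 h2 h3] := main spread; tfae.
have [h1 h2 h3] := main (exchangeable_spreadable phi_state exch phi_GNS).
have [b1 b2] := block_singletonP phi_state exch phi_GNS.
by tfae => // [/h1/b2|/b1/h2].
Qed.
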